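(* Let $F:\mathbb{R}^n\rightrightarrows\mathbb{R}^n$ be a (nonempty valued) multifunction satisfying condition $(U')$ (defined in the context), and let $\Psi:\mathbb{R}^n\to\mathbb{R}$ be lower semicontinuous. Set $\mathcal{S}:=\{x\in\mathbb{R}^n:\Psi(x)\le 0\}$. If there exists an open set $\mathcal{U}\subseteq\mathbb{R}^n$ containing $\mathcal{S}$ such that $H_F(x,\partial_P\Psi(x))\le 0$ for all $x\in\mathcal{U}$, then $(F,\mathcal{S})$ is strongly invariant.
   Context: $\|\cdot\|$ is the supremum norm on $\mathbb{R}^n$ and $\mathcal{B}_n=\{x\in\mathbb{R}^n:\|x\|\le 1\}$. All multifunctions are nonempty valued. Trajectories and strong invariance: for $T\ge 0$ and $\bar x\in\mathbb{R}^n$, $\mathrm{Traj}_T(F,\bar x)$ is the set of absolutely continuous $y:[0,T]\to\mathbb{R}^n$ with $y(0)=\bar x$ and $\dot y(t)\in F(y(t))$ for Lebesgue-almost all $t\in[0,T]$; these are the trajectories of $F$ starting at $\bar x$. For $S\subseteq\mathbb{R}^n$, $(F,S)$ is strongly invariant if for each $T>0$ and each trajectory $y:[0,T]\to\mathbb{R}^n$ of $F$ with $y(0)\in S$, one has $y(t)\in S$ for all $t\in[0,T]$. The class $\mathcal{C}[0,T]$: the set of all $f:[0,T]\times\mathbb{R}^n\to\mathbb{R}^n$ such that: (C1) for each $x$, $t\mapsto f(t,x)$ is Lebesgue measurable; (C2) for each compact $K\subseteq\mathbb{R}^n$ there is a modulus $\omega_{f,K}$ (a continuous nondecreasing function $[0,\infty)\to[0,\infty)$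 vanishing at $0$) with $\|f(t,x_1)-f(t,x_2)\|\le\omega_{f,K}(\|x_1-x_2\|)$ for all $t\in[0,T]$, $x_1,x_2\in K$; (C3) there are constants $c_1,c_2>0$ with $\|f(t,x)\|\le c_1+c_2\|x\|$ for all $t\in[0,T]$, $x\in\mathbb{R}^n$. Component cone: for $P\subseteq\mathbb{R}^n$, $\mathrm{ccone}\{P\}=\{q\in\mathbb{R}^n:\exists p\in P\text{ such that for every } i,\ q_i=\eta_i p_i\text{ for some }\eta_i\ge 0\}$. $\mathcal{C}'_F([0,T],\bar x)$ is the set of all $f\in\mathcal{C}[0,T]$ for which there exists $\gamma>0$ such that $f(t,x)\in\mathrm{ccone}\{F(x)\}$ for almost all $t\in[0,\gamma)\cap[0,T]$ and all $x\in\bar x+\gamma\mathcal{B}_n$. $F$ is weakly zeroing if for all $x\in\mathbb{R}^n$ and $p\in F(x)$, each of the vectors $(p_1,0,\ldots,0),(0,p_2,0,\ldots,0),\ldots,(0,\ldots,0,p_n)$ belongs to $F(x)$. Condition $(U')$: for each $\bar x\in\mathbb{R}^n$, $T\ge 0$ and $y\in\mathrm{Traj}_T(F,\bar x)$, there exists $f\in\mathcal{C}'_F([0,T],\bar x)$ for which $y$ is the unique (absolutely continuous, almost everywhere) solution of $\dot y(t)=f(t,y(t))$ on $[0,T]$ starting at $\bar x$; moreover, $F$ is weakly zeroing. Hamiltonian: $H_F(x,d)=\sup\{\langle v,d\rangle:v\in F(x)\}\in[-\infty,+\infty]$. For $D\subseteq\mathbb{R}^n$, $H_F(x,D)\le 0$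 means $H_F(x,d)\le 0$ for all $d\in D$ (vacuously true if $D=\emptyset$). Proximal subgradients: for $\Psi$ lower semicontinuous, $\partial_P\Psi(x)$ is the (possibly empty) set of $\zeta\in\mathbb{R}^n$ for which there exist $\sigma>0$, $\eta>0$ with $\Psi(x')\ge\Psi(x)+\langle\zeta,x'-x\rangle-\sigma\|x'-x\|^2$ for all $x'\in x+\eta\mathcal{B}_n$. *)

(* Defs.v *)
From HB Require Import structures.
From mathcomp Require Import all_boot all_order all_algebra.
From mathcomp Require Import all_classical all_reals all_analysis.
Set Implicit Arguments.
Unset Strict Implicit.
Unset Printing Implicit Defensive.
Import Order.TTheory GRing.Theory Num.Theory numFieldNormedType.Exports.
Local Open Scope classical_set_scope.
Local Open Scope ring_scope.

(* R^n is 'rV[R]_n, whose library norm is the supremum norm; a multifunction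
   is a map 'rV[R]_n -> set 'rV[R]_n.  A function on [0, T] is represented by
   a total function on R, and only its values on [0, T] are constrained. *)

Definition dotp (R : realType) (n : nat) (u v : 'rV[R]_n) : R :=
  \sum_(i < n) u ord0 i * v ord0 i.

Definition abs_continuous (R : realType) (n : nat) (a b : R)
    (y : R -> 'rV[R]_n) : Prop :=
  forall e : R, 0 < e -> exists2 d : R, 0 < d &
    forall (N : nat) (u v : 'I_N -> R),
      (forall i, a <= u i /\ u i <= v i /\ v i <= b) ->
      trivIset setT (fun i => `]u i, v i[%classic) ->
      \sum_(i < N) (v i - u i) < d ->
      \sum_(i < N) `|y (v i) - y (u i)| < e.

(* The two-sided derivative at the endpoints 0 and T sees values of y outside
   [0, T], which is harmless because {0, T} is Lebesgue-null. *)
Definition ae_derivative (R : realType) (n : nat) (T : R)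
    (y : R -> 'rV[R]_n) (P : R -> set 'rV[R]_n) : Prop :=
  {ae (@lebesgue_measure R), forall t, 0 <= t <= T ->
    derivable y t 1 /\ P t (derive1 y t)}.

Definition Traj (R : realType) (n : nat) (T : R)
    (F : 'rV[R]_n -> set 'rV[R]_n) (x0 : 'rV[R]_n) : set (R -> 'rV[R]_n) :=
  [set y : R -> 'rV[R]_n | [/\ abs_continuous 0 T y, y 0 = x0 &
             ae_derivative T y (fun t => F (y t))]].

Definition ode_solution (R : realType) (n : nat) (T : R)
    (f : R -> 'rV[R]_n -> 'rV[R]_n) (x0 : 'rV[R]_n) : set (R -> 'rV[R]_n) :=
  [set y : R -> 'rV[R]_n | [/\ abs_continuous 0 T y, y 0 = x0 &
             ae_derivative T y (fun t => [set f t (y t)])]].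

Definition unique_ode_solution (R : realType) (n : nat) (T : R)
    (f : R -> 'rV[R]_n -> 'rV[R]_n) (x0 : 'rV[R]_n) (y : R -> 'rV[R]_n) :
    Prop :=
  ode_solution T f x0 y /\
  forall z, ode_solution T f x0 z -> forall t, 0 <= t <= T -> z t = y t.

Definition strongly_invariant (R : realType) (n : nat)
    (F : 'rV[R]_n -> set 'rV[R]_n) (S : set 'rV[R]_n) : Prop :=
  forall (T : R) (y : R -> 'rV[R]_n), 0 < T -> Traj T F (y 0) y ->
    S (y 0) -> forall t, 0 <= t <= T -> S (y t).

(* The library's default sigma-algebra on R is the Borel one; Lebesgue
   measurability refers to the Caratheodory sigma-algebra of the outer measure
   induced by interval length. *)
Definition lebesgue_measurable_fun (R : realType) (D : set R) (g : R -> R) :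
    Prop :=
  @measurable_fun _ _
    (caratheodory_type (mu_ext (wlength (@idfun R)))) (measurableTypeR R) D g.

Definition modulus (R : realType) (w : R -> R) : Prop :=
  [/\ {within `[0, +oo[%classic, continuous w},
      forall s t, 0 <= s -> s <= t -> w s <= w t,
      forall s, 0 <= s -> 0 <= w s &
      w 0 = 0].

Definition classC (R : realType) (n : nat) (T : R) :
    set (R -> 'rV[R]_n -> 'rV[R]_n) :=
  [set f : R -> 'rV[R]_n -> 'rV[R]_n | [/\
    forall (x : 'rV[R]_n) (i : 'I_n),
      lebesgue_measurable_fun `[0, T]%classic (fun t => f t x ord0 i),
    forall K : set 'rV[R]_n, compact K -> exists2 w : R -> R, modulus w &
      forall t x1 x2, 0 <= t <= T -> K x1 -> K x2 ->
        `|f t x1 - f t x2| <= w `|x1 - x2| &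
    exists c1 c2 : R, [/\ 0 < c1, 0 < c2 &
      forall t x, 0 <= t <= T -> `|f t x| <= c1 + c2 * `|x|]]].

Definition ccone (R : realType) (n : nat) (P : set 'rV[R]_n) : set 'rV[R]_n :=
  [set q : 'rV[R]_n | exists2 p, P p &
    forall i, exists2 eta : R, 0 <= eta & q ord0 i = eta * p ord0 i].

(* The exceptional null set of times does not depend on x. *)
Definition classC' (R : realType) (n : nat) (F : 'rV[R]_n -> set 'rV[R]_n)
    (T : R) (x0 : 'rV[R]_n) : set (R -> 'rV[R]_n -> 'rV[R]_n) :=
  [set f : R -> 'rV[R]_n -> 'rV[R]_n | classC T f /\ exists2 gamma : R, 0 < gamma &
    {ae (@lebesgue_measure R), forall t, 0 <= t < gamma -> t <= T ->
      forall x, `|x - x0| <= gamma -> ccone (F x) (f t x)}].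

Definition weakly_zeroing (R : realType) (n : nat)
    (F : 'rV[R]_n -> set 'rV[R]_n) : Prop :=
  forall x p, F x p -> forall i : 'I_n, F x (p ord0 i *: delta_mx ord0 i).

Definition condition_U' (R : realType) (n : nat)
    (F : 'rV[R]_n -> set 'rV[R]_n) : Prop :=
  (forall (x0 : 'rV[R]_n) (T : R) (y : R -> 'rV[R]_n),
     0 <= T -> Traj T F x0 y ->
     exists2 f, classC' F T x0 f & unique_ode_solution T f x0 y) /\
  weakly_zeroing F.

Definition hamiltonian (R : realType) (n : nat)
    (F : 'rV[R]_n -> set 'rV[R]_n) (x d : 'rV[R]_n) : \bar R :=
  ereal_sup [set (dotp v d)%:E | v in F x].

Definition prox_subgradient (R : realType) (n : nat) (Psi : 'rV[R]_n -> R)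
    (x : 'rV[R]_n) : set 'rV[R]_n :=
  [set zeta : 'rV[R]_n | exists sigma eta : R, [/\ 0 < sigma, 0 < eta &
    forall x', `|x' - x| <= eta ->
      Psi x + dotp zeta (x' - x) - sigma * `|x' - x| ^+ 2 <= Psi x']].

(* Main.v *)
Require Import Defs.
From HB Require Import structures.
From mathcomp Require Import all_boot all_order all_algebra.
From mathcomp Require Import all_classical all_reals all_analysis.
From mathcomp Require Import measurable_realfun ring lra.
Import Order.TTheory GRing.Theory Num.Theory numFieldNormedType.Exports.
Local Open Scope classical_set_scope.
Local Open Scope ring_scope.

(** Fix a trajectory [y] starting at [x0] with [Psi x0 <= 0] and let [f] be the
    field of condition (U') for which [y] is the only solution.  Since [F] is
    weakly zeroing, [<f t x, d> <= 0] for small [t], [x] near [x0] and proximal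
    subgradients [d] of [Psi] at [x].  Run the Euler scheme in which the field on
    the [j]-th step is frozen at the minimizer [z] of [Psi + lam |. - y_j|^2] over a
    ball: [2 lam (y_j - z)] is a proximal subgradient at [z], so the minimum of
    the penalized function grows by at most [O(lam h^2)] per step of length [h].
    With [lam] large and then [h] small, [Psi z] stays below [Psi x0 + eps] and
    [z] is close to [y_j].  A limit of the scheme solves the equation of [f],
    hence is [y], and [Psi (y t) <= Psi x0] for small [t] by lower
    semicontinuity.  Looking at the infimum of the times with [Psi (y t) > 0]
    globalizes this. *)

Set Implicit Arguments.
Unset Strict Implicit.

(** * Borel versions of Lebesgue measurable functions *)

Lemma le_mx_norm (R : realType) (n : nat) (v : 'rV[R]_n) (c : R) :
  0 <= c -> `|v| <= c <-> forall i, `|v ord0 i| <= c.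
Proof.
move=> c0; rewrite [(`|v|)]/Num.norm /= mx_normrE; split=> [vc i|vc].
  apply: le_trans vc; apply/bigmax_geP; right.
  by exists (ord0, i).
by apply/bigmax_leP; split=> // -[i j] _ /=; rewrite ord1.
Qed.

(** The Caratheodory sigma-algebra is the completion of the Borel one, so [E] is a Borel set
    together with part of a Borel null set [N], and removing [N] removes that part. *)
Lemma lebesgue_measurable_borel_mod_null (R : realType) (E : set R) :
  ((wlength (@idfun R))^*)%mu.-cara.-measurable E ->
  exists2 A : set (measurableTypeR R), measurable A &
    exists2 N : set (measurableTypeR R),
      measurable N /\ lebesgue_measure N = 0%E & E `\` N = A `\` N.
Proof.
rewrite -completed_caratheodory_measurable g_sigma_completed_algebra_genE.
move=> [A mA [N0 [N [mN muN N0N]]] <-]; exists A => //; exists N => //.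
apply/seteqP; split=> t [].
- by move=> [//|/N0N].
- by move=> At Nt; split=> //; left.
Qed.

(* Lebesgue integration and differentiation in the library are available for
   Borel functions only. *)
Lemma borel_version (R : realType) (T C : R) (g : R -> R) :
  0 <= C -> (forall t, 0 <= t <= T -> `|g t| <= C) ->
  lebesgue_measurable_fun `[0, T]%classic g ->
  exists g' : measurableTypeR R -> measurableTypeR R,
    [/\ measurable_fun setT g', forall t, `|g' t| <= C &
      {ae (@lebesgue_measure R), forall t, 0 <= t <= T -> g' t = g t}].
Proof.
move=> C0 gC mg.
(* [q] enumerates the rationals; a code of no rational yields 0, which only repeats a level. *)
pose q k : R := if @unpickle rat k is Some r then ratr r else 0.
pose E k := `[0, T]%classic `&` g @^-1` `]q k, +oo[%classic.
have mD : ((wlength (@idfun R))^*)%mu.-cara.-measurable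
    (`[0, T]%classic : set R).
  by apply: (@sub_caratheodory _ _ _ (wlength (@idfun R))); exact: measurable_itv.
have mE k := lebesgue_measurable_borel_mod_null (mg mD _ (measurable_itv `]q k, +oo[)).
have /choice[A hA] : forall k, exists p : set (measurableTypeR R) * set (measurableTypeR R),
    [/\ measurable p.1, measurable p.2, lebesgue_measure p.2 = 0%E &
        E k `\` p.2 = p.1 `\` p.2].
  by move=> k; have [A mA [N [mN N0] EN]] := mE k; exists (A, N).
pose N := \bigcup_k (A k).2.
have mN : measurable N by apply: bigcupT_measurable => k; have [] := hA k.
have N0 : lebesgue_measure.-negligible N.
  apply: negligible_bigcup => k; have [_ mk k0 _] := hA k.
  by exists (A k).2; split.
have mEN k : measurable (E k `\` N : set (measurableTypeR R)).
  have [mA1 _ _ EA] := hA k.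
  suff -> : E k `\` N = (A k).1 `\` N by exact: measurableD.
  have sub : (A k).2 `<=` N by move=> t At; exists k.
  have DN X : X `\` N = (X `\` (A k).2) `\` N.
    apply/seteqP; split=> t [Xt Nt]; split=> //; last by case: Xt.
    by split=> // /sub.
  by rewrite (DN (E k)) (DN (A k).1); congr (_ `\` _); exact: EA.
(* Off [N] every superlevel set [E k] is Borel. Setting [g] to 0 on [N] and outside [0, T] extends
   the bound [C] to all times. *)
exists (g \_ (`[0, T]%classic `\` N)); split.
- have mDN : measurable (`[0, T]%classic `\` N : set (measurableTypeR R)).
    by apply: measurableD => //; exact: measurable_itv.
  apply: (proj1 (measurable_restrictT _ mDN)).
  apply: (measurability _ (RGenOInfty.measurableE R)).
  move=> _ [_ [x ->] <-].
  (* A value exceeds [x] exactly when it exceeds some rational level above [x]. *)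
  suff -> : (`[0, T] `\` N) `&` g @^-1` `]x, +oo[ =
      \bigcup_(k in [set k | x < q k]) (E k `\` N).
    by apply: bigcup_measurable => k _; exact: mEN.
  apply/seteqP; split=> [t [[Tt Nt]]|t [k /= xq [[Tt]]]] /=; rewrite !in_itv/= !andbT.
    move=> /rat_in_itvoo[r]; rewrite in_itv/= => /andP[xr rg].
    exists (pickle r); rewrite /= /E /q pickleK //.
    by do 2!split=> //; rewrite /= in_itv/= rg.
  by move=> qg Nt; split=> //; apply: lt_trans qg.
- move=> t; rewrite patchE; case: ifPn => [|_]; last by rewrite normr0.
  by rewrite inE => -[+ _]; rewrite /= in_itv/=; exact: gC.
- apply: negligibleS N0 => t /=; apply: contra_notP => Nt /andP[t0 tT].
  by rewrite patchE mem_set //; split=> //=; rewrite in_itv/= t0.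
Qed.

Lemma negligible_shift (R : realType) (a : R) (A : set R) :
  (@lebesgue_measure R).-negligible A ->
  (@lebesgue_measure R).-negligible [set t | A (t + a)].
Proof.
move=> [B [mB B0 AB]].
pose f : measurableTypeR R -> measurableTypeR R := fun t => t + a.
have mf : measurable_fun setT f by exact: measurable_funD.
pose fm : {mfun measurableTypeR R >-> measurableTypeR R} :=
  HB.pack f (isMeasurableFun.Build _ _ _ _ f mf).
exists (f @^-1` B); split=> [| |t /AB//].
  by rewrite -[X in measurable X]setTI; exact: (mf measurableT).
(* Translation preserves the length of intervals, so by uniqueness the pushforward is Lebesgue
   measure itself. *)
transitivity (pushforward lebesgue_measure fm B) => //.
rewrite -B0; symmetry; apply: lebesgue_measure_unique => // _ [[x y] _ <-] /=.
rewrite /pushforward; have -> : fm @^-1` `]x, y] = `]x - a, y - a]%classic.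
  by apply/seteqP; split=> t /=; rewrite !in_itv/= ltrBlDr lerBrDr.
by rewrite !lebesgue_measure_itv/= !lte_fin ltrD2r -!EFinD opprB addrA addrNK.
Qed.

(** * Derivatives and almost everywhere statements *)

Lemma Rintegral_lincomb d (X : measurableType d) (R : realType)
    (mu : {measure set X -> \bar R}) (D : set X) (I : Type) (r : seq I)
    (c : I -> R) (g : I -> X -> R) :
  measurable D -> (forall i, mu.-integrable D (EFin \o g i)) ->
  mu.-integrable D (EFin \o (fun x => \sum_(i <- r) c i * g i x)) /\
  \int[mu]_(x in D) (\sum_(i <- r) c i * g i x) =
    \sum_(i <- r) c i * \int[mu]_(x in D) g i x.
Proof.
move=> mD ig; elim: r => [|i r [IHi IHe]].
  have -> : (fun x => \sum_(i <- [::]) c i * g i x) = cst 0.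
    by apply/funext => x; rewrite big_nil.
  by split; [exact: integrable0|rewrite Rintegral_cst// mul0r big_nil].
have -> : (fun x => \sum_(j <- i :: r) c j * g j x) =
    (fun x => c i * g i x + \sum_(j <- r) c j * g j x).
  by apply/funext => x; rewrite big_cons.
have ic : mu.-integrable D (EFin \o (fun x => c i * g i x)).
  by have := integrableZl mD (c i) (ig i).
split; first by have := integrableD mD ic IHi.
by rewrite RintegralD// IHe RintegralZl// big_cons.
Qed.

(** The increment [h] is not divided out, so estimates on increments of functions add up directly
    and [h = 0] needs no exception. *)
Definition has_deriv_at (R : realType) (V : normedModType R) (y : R -> V)
    (t : R) (v : V) : Prop :=
  forall e : R, 0 < e -> exists2 d : R, 0 < d &
    forall h, `|h| < d -> `|y (t + h) - y t - h *: v| <= e * `|h|.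

Lemma has_deriv_at_derive1 (R : realType) (V : normedModType R) (y : R -> V)
    (t : R) (v : V) :
  has_deriv_at y t v -> derivable y t 1 /\ derive1 y t = v.
Proof.
move=> yt; suff H : (fun h => h^-1 *: ((y \o shift t) (h *: 1) - y t)) h @[h --> 0^'] --> v.
  split; first by apply/cvg_ex; exists v.
  by rewrite derive1E; exact: cvg_lim.
apply/cvgrPdist_le => e e0; have [d d0 H] := yt e e0.
near=> h; have h0 : h != 0 by near: h; exact: nbhs_dnbhs_neq.
have hd : `|h| < d by near: h; apply: dnbhs0_lt.
rewrite /= [h *: 1]mulr1 [h + t]addrC; move: (y (t + h) - y t) (H h hd) => w Hw.
rewrite [X in `|X|](_ : _ = - h^-1 *: (w - h *: v)); last first.
  by rewrite scalerBr scalerA mulNr mulVf // scaleN1r opprK scaleNr addrC.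
by rewrite normrZ normrN normfV ler_pdivrMl ?normr_gt0 // mulrC.
Unshelve. all: by end_near. Qed.

Lemma derive1_has_deriv_at (R : realType) (y : R -> R) (t : R) :
  derivable y t 1 -> has_deriv_at y t (derive1 y t).
Proof.
move=> yt e e0; rewrite derive1E; set v := 'D_1 y t.
have : (fun h => h^-1 *: ((y \o shift t) (h *: 1) - y t)) h @[h --> 0^'] --> v.
  exact: yt.
move=> /cvgrPdist_le/(_ e e0) H.
have [d /= d0 dH] : \forall h \near (0 : R), h != 0 ->
    `|v - h^-1 *: ((y \o shift t) (h *: 1) - y t)| <= e by exact: H.
exists d => // h hd; have [->|h0] := eqVneq h 0.
  by rewrite addr0 subrr scale0r subrr !normr0 mulr0.
have := dH h; rewrite /ball/= sub0r normrN => /(_ hd h0).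
rewrite /= [h *: 1]mulr1 [h + t]addrC; move: (y (t + h) - y t) => w vh.
rewrite [X in `|X|](_ : _ = - h *: (v - h^-1 *: w)).
  by rewrite normrZ normrN mulrC ler_wpM2r.
by rewrite scalerBr scalerA mulNr mulfV // scaleN1r opprK scaleNr addrC.
Qed.

Lemma has_deriv_at_row (R : realType) (n : nat) (y : R -> 'rV[R]_n) (t : R)
    (v : 'rV[R]_n) :
  (forall i, has_deriv_at (fun s => y s ord0 i) t (v ord0 i)) ->
  has_deriv_at y t v.
Proof.
move=> yt e e0.
have /choice[d dP] : forall i, exists d : R, 0 < d /\ forall h, `|h| < d ->
    `|y (t + h) ord0 i - y t ord0 i - h *: v ord0 i| <= e * `|h|.
  by move=> i; have [d d0 H] := yt i e e0; exists d.
exists (\big[Num.min/1]_i d i).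
  by apply: lt_bigmin => // i _; have [] := dP i.
move=> h hd; apply/le_mx_norm; first by rewrite mulr_ge0 // ltW.
move=> i; rewrite !mxE; apply: (dP i).2; apply: lt_le_trans hd _.
exact: bigmin_le_cond.
Qed.

Lemma lebesgue_aeS (R : realType) (P Q : R -> Prop) :
  (forall t, P t -> Q t) -> {ae (@lebesgue_measure R), forall t, P t} ->
  {ae (@lebesgue_measure R), forall t, Q t}.
Proof. by move=> PQ; apply: negligibleS => t /=; apply: contra_not; exact: PQ. Qed.

Lemma lebesgue_ae_countable (R : realType) (I : countType) (P : I -> R -> Prop) :
  (forall i, {ae (@lebesgue_measure R), forall t, P i t}) ->
  {ae (@lebesgue_measure R), forall t, forall i, P i t}.
Proof.
move=> aeP.
have : {ae (@lebesgue_measure R), forall t, forall k : nat,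
    if unpickle k is Some i then P i t else True}.
  apply: ae_foralln => k; case: (unpickle k) => [i|]; first exact: aeP.
  exact: aeW.
by apply: lebesgue_aeS => t H i; have := H (pickle i); rewrite pickleK.
Qed.

Lemma lebesgue_aeS2 (R : realType) (P Q S : R -> Prop) :
  (forall t, P t -> Q t -> S t) -> {ae (@lebesgue_measure R), forall t, P t} ->
  {ae (@lebesgue_measure R), forall t, Q t} ->
  {ae (@lebesgue_measure R), forall t, S t}.
Proof.
move=> PQS aP aQ; apply: negligibleS (negligibleU aP aQ) => t /= nS.
by apply/not_andP => -[Pt Qt]; apply: nS; exact: PQS.
Qed.

(** * Primitives in time of a Caratheodory field *)

Lemma bounded_borel_integrable (R : realType) (g : measurableTypeR R -> measurableTypeR R)
    (C : R) (A : set (measurableTypeR R)) :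
  measurable_fun setT g -> (forall t, `|g t| <= C) -> measurable A ->
  (lebesgue_measure A < +oo)%E ->
  lebesgue_measure.-integrable A (EFin \o g).
Proof.
move=> mg gC mA fA; apply: measurable_bounded_integrable => //.
- exact: measurable_funTS.
- by exists C; split; [exact: num_real|move=> M CM t _; exact: le_trans (gC t) (ltW CM)].
Qed.

Lemma bounded_borel_locally_integrable (R : realType)
    (g : measurableTypeR R -> measurableTypeR R) (C : R) :
  measurable_fun setT g -> (forall t, `|g t| <= C) ->
  locally_integrable [set: R] g.
Proof.
move=> mg gC; split=> //; first exact: openT.
move=> K _ cK.
have /integrableP[] // := bounded_borel_integrable mg gC (compact_measurable cK)
  (compact_finite_measure cK).
Qed.

(** [G x] stands for the integral of [f r x] from time 0. The second clause is monotonicity of the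
    integral for a combination of two frozen fields; the choice of [d] and [d'] turns it into a
    Lipschitz bound, a comparison of two frozen points, or a sign condition. *)
Definition primitive (R : realType) (n : nat) (T : R)
    (f : R -> 'rV[R]_n -> 'rV[R]_n) (G : 'rV[R]_n -> R -> 'rV[R]_n) : Prop :=
  (forall x, {ae (@lebesgue_measure R), forall t, 0 < t < T ->
     has_deriv_at (G x) t (f t x)}) /\
  (forall x x' d d' c s t, 0 <= s -> s <= t -> t <= T ->
     {ae (@lebesgue_measure R), forall r, s <= r <= t ->
       dotp (f r x) d + dotp (f r x') d' <= c} ->
     dotp (G x t - G x s) d + dotp (G x' t - G x' s) d' <= c * (t - s)).

Lemma caratheodory_primitive (R : realType) (n : nat) (T : R)
    (f : R -> 'rV[R]_n -> 'rV[R]_n) :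
  classC T f -> exists G, primitive T f G.
Proof.
move=> [mf _ [c1 [c2 [c10 c20 fb]]]].
pose C (x : 'rV[R]_n) := c1 + c2 * `|x|.
have C0 x : 0 <= C x by rewrite addr_ge0 ?mulr_ge0 // ltW.
have /choice[g gP] : forall xi : 'rV[R]_n * 'I_n,
    exists g : measurableTypeR R -> measurableTypeR R,
    [/\ measurable_fun setT g, forall t, `|g t| <= C xi.1 &
      {ae (@lebesgue_measure R), forall t, 0 <= t <= T -> g t = f t xi.1 ord0 xi.2}].
  move=> [x i] /=; apply: borel_version => // t tT.
  by have /(le_mx_norm _ (C0 x)) := fb t x tT.
have ig x i A : measurable A -> (@lebesgue_measure R A < +oo)%E ->
    (@lebesgue_measure R).-integrable A (EFin \o g (x, i)).
  by have [mg gC _] := gP (x, i); exact: bounded_borel_integrable mg gC.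
have cc_lty (a b : R) : (@lebesgue_measure R `[a, b] < +oo)%E.
  by rewrite lebesgue_measure_itv/= -EFinB; case: ifP => _; rewrite ltry.
have oc_lty (a b : R) : (@lebesgue_measure R `]a, b] < +oo)%E.
  by rewrite lebesgue_measure_itv/= -EFinB; case: ifP => _; rewrite ltry.
exists (fun x t => \row_i \int[lebesgue_measure]_(r in `[0, t]) g (x, i) r); split.
  move=> x.
  pose P i t := 0 < t < T -> has_deriv_at
    (fun t => \int[lebesgue_measure]_(r in `[0, t]) g (x, i) r) t (f t x ord0 i).
  have aeP : {ae (@lebesgue_measure R), forall t, forall i, P i t}.
    apply: lebesgue_ae_countable => i; have [mg gC gf] := gP (x, i).
    have iy y : (@lebesgue_measure R).-integrable `[0, y] (EFin \o g (x, i)).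
      exact: ig (measurable_itv _) (cc_lty _ _).
    have := FTC1 (a := BLeft 0) iy (bounded_borel_locally_integrable mg gC).
    apply: lebesgue_aeS2 gf => t gft ft /andP[t0 tT].
    case: ft => [|dt dE]; first by rewrite ?bnd_simp ?ltW.
    by have := derive1_has_deriv_at dt; rewrite dE gft ?ltW.
  apply: lebesgue_aeS aeP => t H tT; apply: has_deriv_at_row => i.
  apply: (eq_ind _ (fun F => has_deriv_at F t _) (H i tT)).
  by apply/funext => r; rewrite mxE.
move=> x x' d d' c s t s0 st tT le_c.
have Gi z i : (\row_i \int[lebesgue_measure]_(r in `[0, t]) g (z, i) r -
    \row_i \int[lebesgue_measure]_(r in `[0, s]) g (z, i) r) ord0 i =
    \int[lebesgue_measure]_(r in `]s, t]) g (z, i) r.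
  rewrite !mxE; apply: (@Rintegral_itvB _ _ (BLeft 0) (BRight t)) => //.
  exact: ig (measurable_itv _) (cc_lty _ _).
have mst : measurable (`]s, t]%classic : set (measurableTypeR R)).
  exact: measurable_itv.
have igst z i := ig z i _ mst (oc_lty s t).
have [iphi phiE] := Rintegral_lincomb (index_enum 'I_n) (fun i => d ord0 i) mst (igst x).
have [ipsi psiE] := Rintegral_lincomb (index_enum 'I_n) (fun i => d' ord0 i) mst (igst x').
pose phi r := \sum_i d ord0 i * g (x, i) r.
pose psi r := \sum_i d' ord0 i * g (x', i) r.
have dotG z (w : 'rV[R]_n) : dotp (\row_i \int[lebesgue_measure]_(r in `[0, t]) g (z, i) r -
    \row_i \int[lebesgue_measure]_(r in `[0, s]) g (z, i) r) w =
    \sum_i w ord0 i * \int[lebesgue_measure]_(r in `]s, t]) g (z, i) r.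
  by apply: eq_bigr => i _; rewrite Gi mulrC.
rewrite !dotG -phiE -psiE -RintegralD //.
have ic : (@lebesgue_measure R).-integrable `]s, t] (EFin \o cst c).
  exact: (bounded_borel_integrable (C := `|c|)).
(* The bound by [c] holds only almost everywhere; truncation at [c] leaves the integral unchanged
   and makes the bound pointwise. *)
pose chi r := Num.min (phi r + psi r) c.
have isum : (@lebesgue_measure R).-integrable `]s, t] (EFin \o (fun r => phi r + psi r)).
  by have := integrableD mst iphi ipsi.
have ichi : (@lebesgue_measure R).-integrable `]s, t] (EFin \o chi).
  have icc : (@lebesgue_measure R).-integrable `]s, t] (EFin \o cst `|c|).
    exact: (@bounded_borel_integrable _ _ (Num.norm (Num.norm c))).
  have := integrableD mst (integrable_norm isum) icc.
  apply: le_integrable => //.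
    apply/measurable_EFinP; apply: measurable_minr => //.
    by have /integrableP[/measurable_EFinP] := isum.
  move=> r _; rewrite /= lee_fin [leRHS]ger0_norm ?addr_ge0 //.
  by rewrite /chi minEle; case: ifP => _; rewrite ?lerDl ?lerDr.
have -> : \int[lebesgue_measure]_(r in `]s, t]) (phi r + psi r) =
    \int[lebesgue_measure]_(r in `]s, t]) chi r.
  congr fine; apply: ae_eq_integral => //.
  - by have /integrableP[] := isum.
  - by have /integrableP[] := ichi.
  have aeg z : {ae (@lebesgue_measure R), forall r, forall i, 0 <= r <= T ->
      g (z, i) r = f r z ord0 i}.
    by apply: lebesgue_ae_countable => i; have [] := gP (z, i).
  have aegg := lebesgue_aeS2 (fun r => @conj _ _) (aeg x) (aeg x').
  apply: lebesgue_aeS2 aegg le_c => r [gx gx'] le_c.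
  rewrite /= in_itv/= => /andP[sr rt].
  have r0T : 0 <= r <= T by rewrite (le_trans s0 (ltW sr)) (le_trans rt tT).
  congr (_%:E); symmetry; apply/min_idPl.
  have := le_c; rewrite (ltW sr) rt => /(_ isT); apply: le_trans.
  by apply: lerD; apply: ler_sum => i _; rewrite mulrC ?gx ?gx'.
have : \int[lebesgue_measure]_(r in `]s, t]) chi r <=
    \int[lebesgue_measure]_(r in `]s, t]) cst c r.
  by apply: le_Rintegral => // r _; rewrite ge_min lexx orbT.
move=> /le_trans; apply; rewrite Rintegral_cst //.
have -> : fine (@lebesgue_measure R `]s, t]) = t - s.
  rewrite lebesgue_measure_itv/= lte_fin -EFinB.
  by have [//|ts] := ltP s t; rewrite (@le_anti _ _ s t) ?st ?subrr.
by [].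
Qed.

Lemma dotp_delta (R : realType) (n : nat) (v : 'rV[R]_n) (i : 'I_n) (a : R) :
  dotp v (a *: delta_mx ord0 i) = a * v ord0 i.
Proof.
rewrite /dotp (bigD1 i) //= big1 => [|j ji]; rewrite !mxE eqxx ?eqxx /=.
  by rewrite addr0 mulr1 mulrC.
by rewrite (negbTE ji) mulr0 mulr0.
Qed.

Lemma dotpr0 (R : realType) (n : nat) (v : 'rV[R]_n) : dotp v 0 = 0.
Proof. by rewrite /dotp big1 // => i _; rewrite mxE mulr0. Qed.

Section PrimitiveTheory.
Context (R : realType) (n : nat) (T : R) (f : R -> 'rV[R]_n -> 'rV[R]_n).
Context (G : 'rV[R]_n -> R -> 'rV[R]_n) (fG : primitive T f G).

Lemma primitive_distance x x' c s t : 0 <= s -> s <= t -> t <= T ->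
  (forall r, 0 <= r <= T -> `|f r x - f r x'| <= c) ->
  `|(G x t - G x s) - (G x' t - G x' s)| <= c * (t - s).
Proof.
move=> s0 st tT fc.
have sT : 0 <= s <= T by rewrite s0 (le_trans st).
have c0 : 0 <= c by apply: le_trans (fc s sT).
apply/le_mx_norm => [|i]; first by rewrite mulr_ge0 // subr_ge0.
have fci r : s <= r <= t -> `|f r x ord0 i - f r x' ord0 i| <= c.
  move=> /andP[sr rt]; have := fc r; rewrite (le_trans s0 sr) (le_trans rt tT).
  by move=> /(_ isT) /(le_mx_norm _ c0)/(_ i); rewrite !mxE.
(* Opposite multiples of a basis vector at [x] and [x'] isolate one coordinate of the difference;
   [a = 1] and [a = -1] together bound its absolute value. *)
have H (a : R) : `|a| <= 1 -> a * ((G x t - G x s) - (G x' t - G x' s)) ord0 i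
    <= c * (t - s).
  move=> a1; have := fG.2 x x' (a *: delta_mx ord0 i) (- a *: delta_mx ord0 i) c s t s0 st tT.
  rewrite !dotp_delta mulNr -mulrBr => H.
  have -> : (G x t - G x s - (G x' t - G x' s)) ord0 i =
      (G x t - G x s) ord0 i - (G x' t - G x' s) ord0 i by rewrite !mxE.
  apply: H; apply: aeW => r srt.
  rewrite !dotp_delta mulNr -mulrBr; apply: le_trans (ler_norm _) _.
  by rewrite normrM; apply: le_trans (ler_wpM2r _ a1) _; rewrite // mul1r fci.
rewrite ler_norml lerNl -[X in X <= _ ]mulN1r -[X in _ && (X <= _)]mul1r.
by rewrite !H // ?normrN normr1.
Qed.

Lemma primitive_lipschitz x c s t : 0 <= s -> s <= t -> t <= T ->
  (forall r, 0 <= r <= T -> `|f r x| <= c) -> `|G x t - G x s| <= c * (t - s).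
Proof.
move=> s0 st tT fc.
have sT : 0 <= s <= T by rewrite s0 (le_trans st).
have c0 : 0 <= c by apply: le_trans (fc s sT).
apply/le_mx_norm => [|i]; first by rewrite mulr_ge0 // subr_ge0.
have H (a : R) : `|a| <= 1 -> a * (G x t - G x s) ord0 i <= c * (t - s).
  move=> a1; have := fG.2 x x (a *: delta_mx ord0 i) 0 c s t s0 st tT.
  rewrite !dotp_delta !dotpr0 addr0; apply; apply: aeW => r /andP[sr rt].
  rewrite dotp_delta dotpr0 addr0; apply: le_trans (ler_norm _) _.
  rewrite normrM; apply: le_trans (ler_wpM2r _ a1) _; rewrite // mul1r.
  have := fc r; rewrite (le_trans s0 sr) (le_trans rt tT).
  by move=> /(_ isT) /(le_mx_norm _ c0).
rewrite ler_norml lerNl -[X in X <= _ ]mulN1r -[X in _ && (X <= _)]mul1r.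
by rewrite !H // ?normrN normr1.
Qed.

Lemma primitive_dotp_le0 x d s t : 0 <= s -> s <= t -> t <= T ->
  {ae (@lebesgue_measure R), forall r, s <= r <= t -> dotp (f r x) d <= 0} ->
  dotp (G x t - G x s) d <= 0.
Proof.
move=> s0 st tT fd; have := fG.2 x x d 0 0 s t s0 st tT.
rewrite dotpr0 addr0 mul0r; apply.
by apply: lebesgue_aeS fd => r; rewrite dotpr0 addr0.
Qed.

End PrimitiveTheory.

(** By compactness the image of [U] has a cluster point [p]. An ultrafilter contains either the set
    where [u] is [e]-close to [p] or its complement, and clustering at [p] excludes the
    complement. *)
Lemma ultra_limit (R : realType) (V : normedModType R) (X : Type)
    (U : set_system X) (u : X -> V) (K : set V) :
  UltraFilter U -> compact K -> U [set k | K (u k)] ->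
  exists2 p, K p & forall e, 0 < e -> U [set k | `|u k - p| <= e].
Proof.
move=> UU cK UK.
have PU : ProperFilter U by exact: ultra_proper.
have [|p [Kp up]] := cK (u @ U) _; first by [].
exists p => // e e0.
have [//|UC] := in_ultra_setVsetC [set k | `|u k - p| <= e] UU.
have [v [/= nv]] : ~` [set v | `|v - p| <= e] `&` ball p e !=set0.
  by apply: up; [exact: UC|exact: nbhsx_ballx].
by rewrite -ball_normE /= distrC => /ltW.
Qed.

(** * Euler schemes with frozen fields *)

Lemma subr_subACA (V : zmodType) (a b c d : V) :
  (a - b) - (c - d) = (a - c) - (b - d).
Proof. by rewrite !opprD addrACA. Qed.

(** Since [c1 + c2 * (a j + 1)] is [c2] times [a j + 1 + c1 / c2], the latter quantity grows per
    step by a factor of at most [1 + c2 * h], hence at most [expR (c2 * h)]. *)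
Lemma discrete_gronwall (R : realType) (a : nat -> R) (c1 c2 h T : R) (N : nat) :
  0 <= a 0 -> 0 < c1 -> 0 < c2 -> 0 <= h -> N%:R * h <= T ->
  (forall j, (j < N)%N -> a j.+1 <= a j + (c1 + c2 * (a j + 1)) * h) ->
  forall j, (j <= N)%N -> a j + 1 <= (a 0 + 1 + c1 / c2) * expR (c2 * T).
Proof.
move=> a0 c10 c20 h0 NT aS.
have c12 : 0 < c1 / c2 by rewrite divr_gt0.
have b0 : 0 <= a 0 + 1 + c1 / c2 by lra.
have aE j : (j <= N)%N ->
    a j + 1 + c1 / c2 <= (a 0 + 1 + c1 / c2) * expR (c2 * (j%:R * h)).
  elim: j => [|j IH] jN; first by rewrite mul0r mulr0 expR0 mulr1.
  have := IH (ltnW jN); have := aS j jN; set b := a j => aj bj.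
  apply: (@le_trans _ _ ((b + 1 + c1 / c2) * (1 + c2 * h))).
    suff -> : (b + 1 + c1 / c2) * (1 + c2 * h) =
      b + (c1 + c2 * (b + 1)) * h + 1 + c1 / c2 by lra.
    by field; rewrite gt_eqF.
  have -> : c2 * (j.+1%:R * h) = c2 * (j%:R * h) + c2 * h by rewrite -natr1; ring.
  rewrite expRD mulrA.
  have h1 : 0 <= 1 + c2 * h by rewrite addr_ge0 // mulr_ge0 // ltW.
  apply: le_trans (ler_wpM2r h1 bj) _.
  by rewrite ler_wpM2l ?expR_ge1Dx // mulr_ge0 // expR_ge0.
move=> j jN; apply: (@le_trans _ _ (a j + 1 + c1 / c2)); first by lra.
apply: le_trans (aE j jN) _; rewrite ler_wpM2l // ler_expR ler_wpM2l ?(ltW c20) //.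
by apply: le_trans NT; rewrite ler_wpM2r // ler_nat.
Qed.

Lemma telescope_le (R : realType) (V : normedModType R) (u : nat -> V) (c : R)
    (i m : nat) :
  (forall l, (i <= l < i + m)%N -> `|u l.+1 - u l| <= c) ->
  `|u (i + m)%N - u i| <= c * m%:R.
Proof.
elim: m => [|m IH] H; first by rewrite addn0 subrr normr0 mulr0.
rewrite addnS -natr1 mulrDr mulr1 -(subrKA (u (i + m)%N)) addrC.
apply: le_trans (ler_normD _ _) _; apply: lerD.
  by apply: IH => l /andP[il lm]; apply: H; rewrite il addnS ltnW.
by apply: H; rewrite leq_addr addnS ltnS leqnn.
Qed.

(** Each step integrates the field frozen at [z j] exactly, so [f], which is only measurable in
    time, is never sampled at an instant. The freezing point may be anything within [eps] of the
    node [y j]. *)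
Record euler_scheme (R : realType) (n : nat) (T : R) (G : 'rV[R]_n -> R -> 'rV[R]_n)
    (x0 : 'rV[R]_n) (N : nat) (eps : R) (y z : nat -> 'rV[R]_n) : Prop := {
  euler0 : y 0%N = x0;
  eulerS : forall j, (j < N)%N -> y j.+1 = y j +
    (G (z j) (j.+1%:R * (T / N%:R)) - G (z j) (j%:R * (T / N%:R)));
  euler_close : forall j, (j <= N)%N -> `|z j - y j| <= eps }.

Section EulerEstimates.
Context (R : realType) (n : nat) (T : R) (f : R -> 'rV[R]_n -> 'rV[R]_n).
Context (G : 'rV[R]_n -> R -> 'rV[R]_n) (fG : primitive T f G).
Context (x0 : 'rV[R]_n) (N : nat) (eps : R) (y z : nat -> 'rV[R]_n).
Context (E : euler_scheme T G x0 N eps y z).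
Context (T0 : 0 < T) (N0 : (0 < N)%N) (eps1 : eps <= 1).
Let h := T / N%:R.

Lemma euler_step_gt0 : 0 < h.
Proof. by rewrite divr_gt0 // ltr0n. Qed.

Lemma euler_stepN : N%:R * h = T.
Proof. by rewrite mulrC divfK // pnatr_eq0 -lt0n. Qed.

Lemma euler_stepS j : j.+1%:R * h - j%:R * h = h.
Proof. by rewrite -natr1; ring. Qed.

Lemma euler_time_le j : (j <= N)%N -> 0 <= j%:R * h <= T.
Proof.
move=> jN; rewrite mulr_ge0 ?ler0n ?(ltW euler_step_gt0) //= -euler_stepN.
by rewrite ler_wpM2r ?ler_nat // ltW // euler_step_gt0.
Qed.

(** As [eps] is at most 1, the growth bound at [z j] is at most [c1 + c2 * (|y j| + 1)], and the
    discrete Gronwall inequality gives a bound independent of [N]. *)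
Lemma euler_bounded (c1 c2 : R) : 0 < c1 -> 0 < c2 ->
  (forall t x, 0 <= t <= T -> `|f t x| <= c1 + c2 * `|x|) ->
  forall j, (j <= N)%N ->
    `|y j| + 1 <= (`|x0| + 1 + c1 / c2) * expR (c2 * T).
Proof.
move=> c10 c20 fb j jN; rewrite -(euler0 E).
apply: (discrete_gronwall (h := h) (N := N) (a := fun j => `|y j|)) jN => //.
- exact: ltW euler_step_gt0.
- by rewrite euler_stepN.
move=> {}j jN; rewrite (eulerS E jN); apply: le_trans (ler_normD _ _) _.
rewrite lerD2l; have /andP[t0 _] := euler_time_le (ltnW jN).
have /andP[_ t1] := euler_time_le jN.
have := primitive_lipschitz (x := z j) (c := c1 + c2 * (`|y j| + 1)) fG t0 _ t1.
rewrite -/h euler_stepS; apply.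
  by rewrite ler_wpM2r ?ler_nat // ltW // euler_step_gt0.
move=> r rT; apply: le_trans (fb _ _ rT) _; rewrite lerD2l ler_wpM2l ?(ltW c20) //.
rewrite -[z j](subrK (y j)) addrC; apply: le_trans (ler_normD _ _) _.
by rewrite lerD2l (le_trans (euler_close E (ltnW jN))).
Qed.

(* [g] is either the primitive [G q] of a frozen field or [0]. *)
Lemma euler_increment (g : R -> 'rV[R]_n) (c : R) i j : (i <= j <= N)%N ->
  (forall l, (i <= l < j)%N -> forall s t, 0 <= s -> s <= t -> t <= T ->
     `|(G (z l) t - G (z l) s) - (g t - g s)| <= c * (t - s)) ->
  `|(y j - y i) - (g (j%:R * h) - g (i%:R * h))| <= c * (j%:R * h - i%:R * h).
Proof.
move=> /andP[ij jN] H; rewrite subr_subACA.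
(* Subtracting [g] at the grid times leaves a telescoping sum of one-step errors, each at most
   [c * h]. *)
have := telescope_le (u := fun l => y l - g (l%:R * h)) (c := c * h) (i := i) (m := j - i).
rewrite subnKC // natrB // => TL.
have -> : c * (j%:R * h - i%:R * h) = c * h * (j%:R - i%:R) by ring.
apply: TL => l /andP[il lj].
rewrite /= -subr_subACA (eulerS E (leq_trans lj jN)) [y l + _]addrC addrK.
have /andP[t0 _] := euler_time_le (ltnW (leq_trans lj jN)).
have /andP[_ t1] := euler_time_le (leq_trans lj jN).
have := H l _ _ _ t0 _ t1; rewrite il lj => /(_ isT).
rewrite euler_stepS; apply.
by rewrite ler_wpM2r ?ler_nat // ltW // euler_step_gt0.
Qed.

End EulerEstimates.

(* The last grid point before [t] is [euler_index T N t * (T / N)]. *)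
Definition euler_index (R : realType) (T : R) (N : nat) (t : R) : nat :=
  Num.truncn (t / (T / N%:R)).

Section EulerStep.
Context (R : realType) (n : nat) (T : R) (f : R -> 'rV[R]_n -> 'rV[R]_n).
Context (G : 'rV[R]_n -> R -> 'rV[R]_n) (fG : primitive T f G).
Context (x0 : 'rV[R]_n) (N : nat) (eps : R) (y z : nat -> 'rV[R]_n).
Context (E : euler_scheme T G x0 N eps y z) (T0 : 0 < T) (N0 : (0 < N)%N).
Let h := T / N%:R.

Let J := euler_index T N.

Lemma euler_indexP t : 0 <= t -> (J t)%:R * h <= t < (J t)%:R * h + h.
Proof.
move=> t0; have h0 : 0 < h := euler_step_gt0 T0 N0.
have /truncn_itv/andP[] : 0 <= t / h by rewrite divr_ge0 // ltW.
by rewrite ler_pdivlMr // ltr_pdivrMr // -natr1 mulrDl mul1r => -> ->.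
Qed.

Lemma euler_index_le t : 0 <= t <= T -> (J t <= N)%N.
Proof.
move=> /andP[t0 tT]; have h0 : 0 < h := euler_step_gt0 T0 N0.
rewrite -(ler_nat R) -(ler_pM2r h0) (euler_stepN T N0).
by apply: le_trans tT; have /andP[] := euler_indexP t0.
Qed.

Lemma euler_index_homo s t : s <= t -> (J s <= J t)%N.
Proof.
move=> st; apply: le_truncn; rewrite ler_wpM2r // invr_ge0 ltW //.
exact: euler_step_gt0.
Qed.

Context (M : R) (M0 : 0 <= M).
Context (fM : forall l r, (l <= N)%N -> 0 <= r <= T -> `|f r (z l)| <= M).

Lemma euler_lipschitz i j : (i <= j <= N)%N ->
  `|y j - y i| <= M * (j%:R * h - i%:R * h).
Proof.
move=> ijN; have /andP[_ jN] := ijN.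
have := euler_increment E T0 N0 (g := fun=> 0) ijN.
rewrite /= subrr subr0; apply => l /andP[_ lj] s t s0 st tT.
rewrite subr0; apply: (primitive_lipschitz fG) => // r; apply: fM.
exact: leq_trans (ltnW lj) jN.
Qed.

Lemma euler_index_subr s t : 0 <= s -> s <= t ->
  0 <= (J t)%:R * h - (J s)%:R * h <= t - s + h.
Proof.
move=> s0 st; have /andP[s1 s2] := euler_indexP s0.
have /andP[t1 t2] := euler_indexP (le_trans s0 st).
have := euler_index_homo st; rewrite -(ler_nat R) => /(ler_wpM2r (ltW (euler_step_gt0 T0 N0))).
by rewrite -/h; lra.
Qed.

Lemma euler_lipschitz_time s t : 0 <= s -> s <= t -> t <= T ->
  `|y (J t) - y (J s)| <= M * (t - s + h).
Proof.
move=> s0 st tT; have ijN : (J s <= J t <= N)%N.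
  by rewrite euler_index_homo // euler_index_le // tT (le_trans s0).
apply: le_trans (euler_lipschitz ijN) _; rewrite ler_wpM2l //.
by have /andP[] := euler_index_subr s0 st.
Qed.

(** All freezing points used between [s] and [t] lie within the argument of [w] from [q], so one
    value of the modulus bounds the deviation of the fields. The term [2 * M * h] pays for rounding
    [s] and [t] down to the grid. *)
Lemma euler_frozen_field (w : R -> R) (q : 'rV[R]_n) s t :
  (forall a b, 0 <= a -> a <= b -> w a <= w b) ->
  (forall l r, (l <= N)%N -> 0 <= r <= T -> `|f r (z l) - f r q| <= w `|z l - q|) ->
  (forall r, 0 <= r <= T -> `|f r q| <= M) ->
  0 <= s -> s <= t -> t <= T ->
  `|(y (J t) - y (J s)) - (G q t - G q s)| <=
    w (`|y (J s) - q| + M * (t - s + h) + eps) * (t - s + h) + 2 * M * h.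
Proof.
move=> w_homo fw fq s0 st tT; set W := w _.
have h0 : 0 < h := euler_step_gt0 T0 N0.
have ijN : (J s <= J t <= N)%N.
  by rewrite euler_index_homo // euler_index_le // tT (le_trans s0).
have /andP[ij jN] := ijN.
have /andP[d0 dle] := euler_index_subr s0 st.
have fW l r : (J s <= l <= J t)%N -> 0 <= r <= T -> `|f r (z l) - f r q| <= W.
  move=> /andP[il lj] rT; have lN := leq_trans lj jN.
  apply: le_trans (fw l r lN rT) _; apply: w_homo => //.
  have -> : z l - q = (y (J s) - q) + (y l - y (J s)) + (z l - y l).
    by apply/rowP => i; rewrite !mxE; ring.
  apply: le_trans (ler_normD _ _) _; apply: lerD; last exact: (euler_close E).
  apply: le_trans (ler_normD _ _) _; rewrite lerD2l.
  have ilN : (J s <= l <= N)%N by rewrite il.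
  apply: le_trans (euler_lipschitz ilN) _; rewrite ler_wpM2l //.
  apply: le_trans dle; by rewrite lerD2r ler_wpM2r ?ler_nat // (ltW h0).
have W0 : 0 <= W.
  apply: le_trans (fW (J s) 0 _ _); rewrite ?leqnn // lexx ltW //.
have /andP[s1 s2] := euler_indexP s0.
have /andP[t1 t2] := euler_indexP (le_trans s0 st).
have Js0 : 0 <= (J s)%:R * h by rewrite mulr_ge0 // ltW.
have Jt0 : 0 <= (J t)%:R * h by rewrite mulr_ge0 // ltW.
have H1 : `|(y (J t) - y (J s)) - (G q ((J t)%:R * h) - G q ((J s)%:R * h))| <=
    W * (t - s + h).
  apply: le_trans (_ : _ <= W * ((J t)%:R * h - (J s)%:R * h)) _; last first.
    by rewrite ler_wpM2l.
  apply: (euler_increment E T0 N0) => // l /andP[il lj] a b a0 ab bT.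
  by apply: (primitive_distance fG) => // r; apply: fW; rewrite il ltnW.
have H2 : `|G q t - G q ((J t)%:R * h)| <= M * h.
  apply: le_trans (primitive_lipschitz fG Jt0 t1 tT fq) _.
  by rewrite ler_wpM2l //; lra.
have H3 : `|G q s - G q ((J s)%:R * h)| <= M * h.
  apply: le_trans (primitive_lipschitz fG Js0 s1 (le_trans st tT) fq) _.
  by rewrite ler_wpM2l //; lra.
set a := y (J t) - y (J s) in H1 *.
have -> : a - (G q t - G q s) = (a - (G q ((J t)%:R * h) - G q ((J s)%:R * h))) -
  (G q t - G q ((J t)%:R * h)) + (G q s - G q ((J s)%:R * h)).
  by apply/rowP => i; rewrite !mxE; ring.
apply: le_trans (ler_normD _ _) _.
have := ler_normB (a - (G q ((J t)%:R * h) - G q ((J s)%:R * h))) (G q t - G q ((J t)%:R * h)).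
by lra.
Qed.

End EulerStep.

(** * Compact balls, moduli and perturbation estimates for the limit passage *)

Lemma compact_norm_ball (R : realType) (n : nat) (a : 'rV[R]_n) (r : R) :
  compact [set v : 'rV[R]_n | `|v - a| <= r].
Proof.
apply: bounded_closed_compact.
  exists (`|a| + r); split; first exact: num_real.
  move=> M arM v /= va; apply: le_trans (ltW arM).
  by rewrite -[v](subrK a) addrC; apply: le_trans (ler_normD _ _) _; rewrite lerD2l.
have /continuous_closedP/(_ _ (@closed_le _ r)) :
    continuous (fun v : 'rV[R]_n => `|v - a|); last by [].
move=> v; apply: (@cvg_norm _ _ _ (nbhs v) _ (fun u => u - a)).
exact: (@cvgB _ _ _ (nbhs v) _ id (cst a) _ _ cvg_id (cvg_cst _)).
Qed.

Lemma modulus_small (R : realType) (w : R -> R) : modulus w ->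
  forall e, 0 < e -> exists2 d, 0 < d & forall s, 0 <= s -> s <= d -> w s <= e.
Proof.
move=> [wc wh _ w0] e e0.
have /continuous_within_itvcyP[_ /cvgrPdist_le/(_ e e0)[d /= d0 dH]] := wc.
exists (d / 2); first by rewrite divr_gt0.
move=> s s0 sd; have [->|sn0] := eqVneq s 0; first by rewrite w0 ltW.
have sp : 0 < s by rewrite lt_neqAle eq_sym sn0.
have := dH s; rewrite /ball/= sub0r normrN gtr0_norm // w0 sub0r normrN.
have sd' : s < d by lra.
by move=> /(_ sd' sp); exact: le_trans (ler_norm _).
Qed.

Lemma ler_norm_perturb (R : realType) (V : normedModType R) (a b a' b' g : V) :
  `|(a' - b') - g| <= `|(a - b) - g| + `|a - a'| + `|b - b'|.
Proof.
rewrite (_ : a' - b' - g = (a - b - g) - (a - a') + (b - b')).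
  by apply: le_trans (ler_normD _ _) _; rewrite lerD2r ler_normB.
rewrite [_ - g - _]addrAC [RHS]addrAC; congr (_ - g).
by rewrite subr_subACA subrr sub0r opprB addrA subrK.
Qed.

Lemma lebesgue_ae_neq (R : realType) (a : R) :
  {ae (@lebesgue_measure R), forall t, t != a}.
Proof.
have : (@lebesgue_measure R).-negligible [set a].
  by exists [set a]; split=> //; exact: lebesgue_measure_set1.
by apply: negligibleS => t /= /negP; rewrite negbK => /eqP.
Qed.

Section EulerLimit.
Context (R : realType) (n : nat) (T : R) (f : R -> 'rV[R]_n -> 'rV[R]_n).
Context (G : 'rV[R]_n -> R -> 'rV[R]_n) (fC : classC T f) (fG : primitive T f G).
Context (x0 : 'rV[R]_n) (T0 : 0 < T).
Context (N : nat -> nat) (eps : nat -> R) (y z : nat -> nat -> 'rV[R]_n).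
Context (E : forall k, euler_scheme T G x0 (N k) (eps k) (y k) (z k)).
Context (N0 : forall k, (0 < N k)%N) (eps1 : forall k, eps k <= 1).
Context (h_cvg : forall d, 0 < d -> \forall k \near \oo, T / (N k)%:R <= d).
Context (eps_cvg : forall d, 0 < d -> \forall k \near \oo, eps k <= d).
Let h k := T / (N k)%:R.
Let Y k t := y k (euler_index T (N k) t).

(* The scheme converges pointwise along an ultrafilter on the step counts, which
   replaces the Ascoli theorem.  The limit is differentiable wherever the
   primitives of the countably many frozen fields [f t (z k j)] are: there the
   increments of the limit are close to those of [G (z k j)] with [z k j] near
   [yh t]. *)
Lemma euler_limit : exists yh, ode_solution T f x0 yh /\
  forall t, 0 <= t <= T -> forall d, 0 < d -> forall P : set nat, \oo P ->
    exists k j, [/\ P k, (j <= N k)%N, j%:R * h k <= t & `|z k j - yh t| <= d].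
Proof.
have [_ f_cont [c1 [c2 [c10 c20 fb]]]] := fC.
(* [B] bounds all nodes and freezing points uniformly in [k], and [M] bounds the field on the ball
   of radius [B]. *)
pose B := (`|x0| + 1 + c1 / c2) * expR (c2 * T).
pose M := c1 + c2 * B.
have yB k j : (j <= N k)%N -> `|y k j| + 1 <= B.
  exact: (euler_bounded fG (E k) T0 (N0 k) (eps1 k) c10 c20 fb).
have zB k j : (j <= N k)%N -> `|z k j| <= B.
  move=> jN; apply: le_trans (yB k j jN).
  rewrite -[z k j](subrK (y k j)) addrC; apply: le_trans (ler_normD _ _) _.
  by rewrite lerD2l (le_trans (euler_close (E k) jN)).
have B0 : 0 <= B := le_trans (normr_ge0 _) (zB 0%N 0%N (leq0n _)).
have M0 : 0 <= M by apply: addr_ge0; [exact: ltW|apply: mulr_ge0 => //; exact: ltW].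
have fM r q : 0 <= r <= T -> `|q| <= B -> `|f r q| <= M.
  move=> rT qB; apply: le_trans (fb _ _ rT) _.
  by rewrite lerD2l ler_wpM2l // ltW.
have fzM k l r : (l <= N k)%N -> 0 <= r <= T -> `|f r (z k l)| <= M.
  by move=> lN rT; apply: fM => //; exact: zB.
clearbody M.
pose K := [set v : 'rV[R]_n | `|v - 0| <= B].
have cK : compact K by exact: compact_norm_ball.
have KE v : K v <-> `|v| <= B by rewrite /K /= subr0.
have [w wmod fw] := f_cont K cK.
have [_ w_homo w_ge0 _] := wmod.
have w_small := modulus_small wmod.
(* [U] refines the eventual filter: eventual bounds on [h] and [eps] survive, and limits exist at
   all times simultaneously, without extracting subsequences. *)
have [U [UU sU]] := ultraFilterLemma eventually_filter.
have PU : ProperFilter U by exact: ultra_proper.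
have hU d : 0 < d -> U [set k | h k <= d] by move=> d0; apply: sU; exact: h_cvg.
have eU d : 0 < d -> U [set k | eps k <= d] by move=> d0; apply: sU; exact: eps_cvg.
have idxN k t : 0 <= t <= T -> (euler_index T (N k) t <= N k)%N.
  exact: euler_index_le.
have /choice[yh yhP] : forall t, exists v, 0 <= t <= T -> K v /\
    forall e, 0 < e -> U [set k | `|Y k t - v| <= e].
  move=> t; have [tT|] := boolP (0 <= t <= T); last by exists 0.
  have [|p Kp pU] := ultra_limit (u := fun k => Y k t) UU cK; last by exists p.
  apply: filterS filterT => k _; apply/KE.
  by have := yB k _ (idxN k t tT); rewrite -/(Y k t); lra.
have yhK t : 0 <= t <= T -> `|yh t| <= B by move=> /yhP[/KE].
have yhU t : 0 <= t <= T -> forall e, 0 < e -> U [set k | `|Y k t - yh t| <= e].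
  by move=> /yhP[].
have h0 k : 0 < h k := euler_step_gt0 T0 (N0 k).
have ylip k s t : 0 <= s -> s <= t -> t <= T -> `|Y k t - Y k s| <= M * (t - s + h k).
  exact: (euler_lipschitz_time fG (E k) T0 (N0 k) M0 (@fzM k)).
have itvl s t : 0 <= s -> s <= t -> t <= T -> 0 <= s <= T.
  by move=> -> st tT; exact: le_trans st tT.
have itvr s t : 0 <= s -> s <= t -> t <= T -> 0 <= t <= T.
  by move=> s0 st ->; rewrite (le_trans s0 st).
have yh_lip s t : 0 <= s -> s <= t -> t <= T -> `|yh t - yh s| <= M * (t - s).
  move=> s0 st tT; apply/ler_addgt0Pr => e e0.
  have M2 : 0 < 2 + M by lra.
  pose eta := e / (2 + M); have eta0 : 0 < eta by rewrite divr_gt0.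
  have etaE : eta * (2 + M) = e by rewrite divfK // gt_eqF.
  have [k [[kt ks] kh]] := filter_ex (filterI (filterI
    (yhU t (itvr _ _ s0 st tT) _ eta0) (yhU s (itvl _ _ s0 st tT) _ eta0)) (hU _ eta0)).
  rewrite /= in kt ks kh.
  have := ler_norm_perturb (Y k t) (Y k s) (yh t) (yh s) 0.
  rewrite !subr0 => /le_trans; apply; have := ylip k s t s0 st tT.
  have := ler_wpM2l M0 kh; rewrite !mulrDr; lra.
have yh_frozen q s t d : `|q| <= B -> 0 <= s -> s <= t -> t <= T -> 0 < d ->
    `|(yh t - yh s) - (G q t - G q s)| <= w (`|yh s - q| + M * (t - s) + d) * (t - s).
  move=> qB s0 st tT d0; apply/ler_addgt0Pr => e e0; set W := w _.
  have W0 : 0 <= W by apply: w_ge0; rewrite !addr_ge0 ?mulr_ge0 ?subr_ge0 // ltW.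
  have M2 : 0 < 2 + M by lra.
  have W2 : 0 < 2 + W + 2 * M by lra.
  (* The first bound on [eta] fits the errors in the argument of [w] into the slack [d], so no limit
     is taken inside [w]; the second keeps the sum of the remaining errors below [e]. *)
  pose eta := Num.min (d / (2 + M)) (e / (2 + W + 2 * M)).
  have eta0 : 0 < eta by rewrite lt_min !divr_gt0.
  have etad : eta * (2 + M) <= d by rewrite -ler_pdivlMr // ge_min lexx.
  have etae : eta * (2 + W + 2 * M) <= e by rewrite -ler_pdivlMr // ge_min lexx orbT.
  have [k [[[kt ks] kh] ke]] := filter_ex (filterI (filterI (filterI
    (yhU t (itvr _ _ s0 st tT) _ eta0) (yhU s (itvl _ _ s0 st tT) _ eta0)) (hU _ eta0))
    (eU _ eta0)).
  rewrite /= in kt ks kh ke.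
  apply: le_trans (ler_norm_perturb (Y k t) (Y k s) (yh t) (yh s) _) _.
  have fwq l r : (l <= N k)%N -> 0 <= r <= T -> `|f r (z k l) - f r q| <= w `|z k l - q|.
    by move=> lN rT; apply: fw => //; apply/KE => //; exact: zB.
  have := euler_frozen_field fG (E k) T0 (N0 k) M0 (@fzM k) w_homo fwq
    (fun r rT => fM r q rT qB) s0 st tT.
  rewrite -/(h k) -/(Y k t) -/(Y k s); set Wk := w _ => Hk.
  have Mh := ler_wpM2l M0 kh; have Wh := ler_wpM2l W0 kh.
  have hk0 := h0 k.
  have WkW : Wk <= W.
    have ep0 : 0 <= eps k by apply: le_trans (euler_close (E k) (leq0n _)).
    apply: w_homo; first by rewrite !addr_ge0 // mulr_ge0 // addr_ge0 ?subr_ge0 // ltW.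
    have : `|Y k s - q| <= `|Y k s - yh s| + `|yh s - q|.
      by rewrite -{1}[Y k s](subrK (yh s)) -addrA ler_normD.
    by move: Mh etad; rewrite !mulrDr; lra.
  have : Wk * (t - s + h k) <= W * (t - s + h k) by rewrite ler_wpM2r //; lra.
  move: Mh Wh etae Hk kt ks; rewrite [W * (_ + h k)]mulrDr !mulrDr; nra.
have yh_z t : 0 <= t <= T -> forall d, 0 < d -> forall P : set nat, \oo P ->
    exists k j, [/\ P k, (j <= N k)%N, j%:R * h k <= t & `|z k j - yh t| <= d].
  move=> tT d d0 P ooP; have d2 : 0 < d / 2 by rewrite divr_gt0.
  have [k [[kP kt] ke]] := filter_ex (filterI (filterI (sU _ ooP)
    (yhU t tT _ d2)) (eU _ d2)).
  rewrite /= in kt ke.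
  exists k, (euler_index T (N k) t); split=> //; first exact: idxN.
    by have /andP[t0 _] := tT; have /andP[] := euler_indexP T0 (N0 k) t0.
  rewrite -[z k _](subrK (Y k t)) -addrA; apply: le_trans (ler_normD _ _) _.
  have := euler_close (E k) (idxN k t tT); rewrite -/(Y k t); lra.
exists yh; split=> //; split.
- move=> e e0; have M1 : 0 < M + 1 by lra.
  exists (e / (M + 1)); first by rewrite divr_gt0.
  move=> m u v uv _; rewrite ltr_pdivlMr // => sm.
  apply: le_lt_trans sm; rewrite mulr_suml; apply: ler_sum => i _.
  have [u0 [uv1 v1]] := uv i; apply: le_trans (yh_lip _ _ u0 uv1 v1) _.
  by rewrite mulrC ler_wpM2l ?subr_ge0 // lerDl.
- have T0' : 0 <= (0 : R) <= T by rewrite lexx ltW.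
  apply/eqP; rewrite eq_sym -subr_eq0 -normr_le0; apply/ler_addgt0Pr => e e0.
  have [k /=] := filter_ex (yhU 0 T0' _ e0).
  by rewrite /Y /euler_index mul0r truncn0 (euler0 (E k)) add0r.
- pose Q (kj : nat * nat) t := 0 < t < T ->
    has_deriv_at (G (z kj.1 kj.2)) t (f t (z kj.1 kj.2)).
  have aeQ : {ae (@lebesgue_measure R), forall t, forall kj, Q kj t}.
    by apply: lebesgue_ae_countable => kj; exact: fG.1.
  apply: lebesgue_aeS2 aeQ (lebesgue_aeS2 (fun t => @conj _ _)
    (lebesgue_ae_neq 0) (lebesgue_ae_neq T)) => t Qt [tn0 tnT] /andP[t0 tT].
  have {}t0 : 0 < t by rewrite lt_neqAle eq_sym tn0.
  have {}tT : t < T by rewrite lt_neqAle tnT.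
  suff : has_deriv_at yh t (f t (yh t)) by move=> /has_deriv_at_derive1.
  have tT' : 0 <= t <= T by rewrite !ltW.
  move=> e e0; have e3 : 0 < e / 3 by rewrite divr_gt0.
  have [r0 r00 wr] := w_small _ e3.
  (* The argument of [w] has at most four parts of size [r0 / 4]: the distance from [yh t] to [q],
     the length term, the slack, and, for negative [u], the displacement of the base point from [t]
     to [t + u]. *)
  have r4 : 0 < r0 / 4 by rewrite divr_gt0.
  have [k [j [_ jN _]]] := yh_z t tT' _ r4 setT filterT.
  have qB := zB k j jN; have := Qt (k, j); rewrite /Q /= t0 tT => /(_ isT).
  move: (z k j) qB => q qB Gq qt; have [d d0 dG] := Gq _ e3.
  have M4 : 0 < 4 * (M + 1) by lra.
  exists (Num.min (Num.min d (r0 / (4 * (M + 1)))) (Num.min t (T - t))).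
    by rewrite !lt_min d0 t0 subr_gt0 tT divr_gt0.
  move=> u; rewrite !lt_min ltr_pdivlMr // => /andP[/andP[ud ur] /andP[ut uT]].
  have wle x : 0 <= x -> x <= r0 -> w x * `|u| <= e / 3 * `|u|.
    by move=> x0' xr; rewrite ler_wpM2r // wr.
  have frozen : `|(yh (t + u) - yh t) - (G q (t + u) - G q t)| <= e / 3 * `|u|.
    have [u0|u0] := leP 0 u.
      rewrite (ger0_norm u0) in ut uT ur.
      have tu : t + u <= T by lra.
      have := yh_frozen q t (t + u) _ qB (ltW t0) _ tu r4.
      rewrite lerDl [t + u]addrC addrK [u + t]addrC => /(_ u0) /le_trans; apply.
      rewrite -{2}(ger0_norm u0); apply: wle.
        by rewrite !addr_ge0 ?mulr_ge0 // ltW.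
      by rewrite [(`|yh t - q|)]distrC; lra.
    rewrite (ltr0_norm u0) in ut uT ur.
    have tu : 0 <= t + u by lra.
    have tut : t + u <= t by lra.
    have := yh_frozen q (t + u) t _ qB tu tut (ltW tT) r4.
    have -> : yh (t + u) - yh t - (G q (t + u) - G q t) =
        - (yh t - yh (t + u) - (G q t - G q (t + u))).
      by apply/rowP => i; rewrite !mxE; ring.
    have tE : t - (t + u) = `|u| by rewrite ltr0_norm //; lra.
    rewrite normrN tE => /le_trans; apply; apply: wle.
      by rewrite !addr_ge0 ?mulr_ge0 // ltW.
    have := yh_lip (t + u) t tu tut (ltW tT); rewrite tE.
    have := ler_distD (yh t) (yh (t + u)) q.
    rewrite [(`|yh t - q|)]distrC [(`|yh t - _|)]distrC ltr0_norm //; lra.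
  have fq : `|u *: (f t q - f t (yh t))| <= e / 3 * `|u|.
    rewrite normrZ mulrC ler_wpM2r //; apply: le_trans (fw t _ _ tT' _ _) _.
    - exact/KE.
    - by apply/KE; exact: yhK.
    - by apply: wr => //; lra.
  have -> : yh (t + u) - yh t - u *: f t (yh t) =
      (yh (t + u) - yh t - (G q (t + u) - G q t)) +
      (G q (t + u) - G q t - u *: f t q) + u *: (f t q - f t (yh t)).
    by apply/rowP => i; rewrite !mxE; ring.
  apply: le_trans (ler_normD _ _) _.
  apply: le_trans (lerD (ler_normD _ _) (lexx _)) _.
  have := dG u ud; lra.
Qed.

End EulerLimit.

(** * Minimizers of penalized lower semicontinuous functions *)

Lemma seq_argmin (R : realType) (X : eqType) (h : X -> R) (x : X) (s : seq X) :
  exists2 m, m \in x :: s & forall y, y \in x :: s -> h m <= h y.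
Proof.
elim: s x => [|a s IH] x; first by exists x; rewrite ?mem_head // => y /[1!inE] /eqP ->.
have [m ms mP] := IH a; have [hx|hx] := leP (h x) (h m).
  exists x; rewrite ?mem_head // => y; rewrite inE => /predU1P[->//|/mP].
  exact: le_trans.
exists m; first by rewrite inE ms orbT.
by move=> y; rewrite inE => /predU1P[->|/mP//]; exact: ltW.
Qed.

(** Without a minimizer the open sets where [h] exceeds [h y], for [y] in [K], cover [K]. In a
    finite subcover the [y] with the least value lies in none of the sets. *)
Lemma lsc_argmin (R : realType) (n : nat) (h : 'rV[R]_n -> R) (K : set 'rV[R]_n) :
  compact K -> K !=set0 -> lower_semicontinuous (EFin \o h) ->
  exists2 m, K m & forall y, K y -> h m <= h y.
Proof.
move=> cK [x0 Kx0] /lower_semicontinuousP h_open; apply: contrapT => nomin.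
have lower x : K x -> exists2 y, K y & h y < h x.
  move=> Kx; apply: contrapT => nolower; apply: nomin; exists x => // y Ky.
  by rewrite leNgt; apply/negP => yx; apply: nolower; exists y.
move: cK; rewrite compact_cover => /(_ _ K (fun y => [set x | h y < h x])).
case.
- by move=> y _; have := h_open (h y); congr open; apply/seteqP; split=> x; rewrite /= lte_fin.
- by move=> x /lower[y Ky yx]; exists y.
move=> D DK KD; have /finite_seqP[s Ds] := finite_fset D; rewrite Ds in KD.
have sK y : y \in s -> K y.
  by move=> ys; apply/set_mem/DK; have : [set` s] y by []; rewrite -Ds.
have [y0 Dy0 _] := KD _ Kx0.
have [m mD mP] := seq_argmin h y0 s.
have {}mD : m \in s by move: mD; rewrite inE => /predU1P[->|].
have [y Dy /=] := KD _ (sK _ mD); rewrite ltNge mP // inE; apply/orP; right; exact: Dy.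
Qed.

(** * The inner product compared with the supremum norm *)

Lemma dotpDl (R : realType) (n : nat) (u v w : 'rV[R]_n) :
  dotp (u + v) w = dotp u w + dotp v w.
Proof. by rewrite -big_split; apply: eq_bigr => i _; rewrite mxE mulrDl. Qed.

Lemma dotpZl (R : realType) (n : nat) (a : R) (u w : 'rV[R]_n) :
  dotp (a *: u) w = a * dotp u w.
Proof. by rewrite /dotp mulr_sumr; apply: eq_bigr => i _; rewrite mxE mulrA. Qed.

Lemma dotpC (R : realType) (n : nat) (u v : 'rV[R]_n) : dotp u v = dotp v u.
Proof. by apply: eq_bigr => i _; rewrite mulrC. Qed.

Lemma dotpNl (R : realType) (n : nat) (u w : 'rV[R]_n) : dotp (- u) w = - dotp u w.
Proof. by rewrite -scaleN1r dotpZl mulN1r. Qed.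

Lemma dotp_sqrD (R : realType) (n : nat) (u v : 'rV[R]_n) :
  dotp (u + v) (u + v) = dotp u u + 2 * dotp u v + dotp v v.
Proof. by rewrite !dotpDl ![dotp _ (u + v)]dotpC !dotpDl [dotp v u]dotpC; ring. Qed.

Lemma norm_coord_le (R : realType) (n : nat) (u : 'rV[R]_n) i : `|u ord0 i| <= `|u|.
Proof. by have /(le_mx_norm u (normr_ge0 u)) := lexx `|u|. Qed.

Lemma dotp_norm_le (R : realType) (n : nat) (u v : 'rV[R]_n) :
  `|dotp u v| <= n%:R * (`|u| * `|v|).
Proof.
apply: le_trans (ler_norm_sum _ _ _) _.
apply: (@le_trans _ _ (\sum_(i < n) `|u| * `|v|)).
  by apply: ler_sum => i _; rewrite normrM ler_pM // norm_coord_le.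
by rewrite sumr_const card_ord mulr_natl.
Qed.

Lemma sqr_norm_le_dotp (R : realType) (n : nat) (u : 'rV[R]_n) : `|u| ^+ 2 <= dotp u u.
Proof.
have dn i : u ord0 i ^+ 2 <= dotp u u.
  rewrite /dotp (bigD1 i) //= -expr2 lerDl; apply: sumr_ge0 => j _.
  by rewrite -expr2 sqr_ge0.
have d0 : 0 <= dotp u u by apply: sumr_ge0 => i _; rewrite -expr2 sqr_ge0.
rewrite -[leRHS](sqr_sqrtr d0) ler_sqr ?nnegrE ?sqrtr_ge0 //.
apply/le_mx_norm; first exact: sqrtr_ge0.
by move=> i; rewrite -sqrtr_sqr ler_sqrt.
Qed.

Lemma dotp_sqr_le (R : realType) (n : nat) (u : 'rV[R]_n) c : `|u| <= c ->
  dotp u u <= n%:R * c ^+ 2.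
Proof.
move=> uc; apply: le_trans (ler_norm _) _; apply: le_trans (dotp_norm_le _ _) _.
by rewrite ler_wpM2l // -expr2 ler_sqr // nnegrE // (le_trans _ uc).
Qed.

Lemma lsc_penalized (R : realType) (n : nat) (Psi : 'rV[R]_n -> R) (lam : R)
    (a : 'rV[R]_n) : 0 <= lam -> lower_semicontinuous (EFin \o Psi) ->
  lower_semicontinuous (EFin \o (fun x => Psi x + lam * dotp (x - a) (x - a))).
Proof.
move=> lam0 Psi_lsc z c /=; rewrite lte_fin => cz.
(* Half of the gap above [c] is spent on [Psi], the other half on the penalty, whose decrease from
   [z] to [x] is at most [L] times the distance. *)
pose r := (Psi z + lam * dotp (z - a) (z - a) - c) / 2.
have r0 : 0 < r by rewrite divr_gt0 ?subr_gt0.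
have [|V nV VP] := Psi_lsc z (Psi z - r); first by rewrite lte_fin; lra.
pose L := lam * (2 * (n%:R * `|z - a|)).
have L0 : 0 <= L by rewrite !mulr_ge0.
have L1 : 0 < L + 1 by lra.
exists (V `&` ball z (r / (L + 1))).
  by apply: filterI => //; apply: nbhsx_ballx; rewrite divr_gt0.
move=> x [/VP]; rewrite -ball_normE /= !lte_fin ltr_pdivlMr // distrC => Vx zx.
have -> : x - a = (z - a) + (x - z) by rewrite [RHS]addrC addrA subrK.
rewrite (dotp_sqrD (z - a)).
have /ler_normlP[D _] := dotp_norm_le (z - a) (x - z).
have S : 0 <= dotp (x - z) (x - z) by apply: le_trans (sqr_norm_le_dotp _); rewrite sqr_ge0.
have {}D : - (L * `|x - z|) <= lam * (2 * dotp (z - a) (x - z)).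
  rewrite lerNl -!mulrN /L -!mulrA; rewrite ler_wpM2l // ler_wpM2l //.
have LS : 0 <= lam * dotp (x - z) (x - z) by rewrite mulr_ge0.
have := normr_ge0 (x - z); rewrite /r in Vx zx; rewrite !mulrDr; lra.
Qed.

(** Expanding the penalty around [z] turns minimality into the proximal inequality with an error
    [lam] times a Euclidean square, at most [n] times the squared supremum norm. In [n + 1] the 1
    keeps the constant positive in dimension 0. *)
Lemma penalized_argmin_prox_subgradient (R : realType) (n : nat)
    (Psi : 'rV[R]_n -> R) (lam rho : R) (x0 a z : 'rV[R]_n) :
  0 < lam -> `|z - x0| < rho ->
  (forall x, `|x - x0| <= rho -> Psi z + lam * dotp (z - a) (z - a) <=
     Psi x + lam * dotp (x - a) (x - a)) ->
  prox_subgradient Psi z ((2 * lam) *: (a - z)).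
Proof.
move=> lam0 zrho zmin; exists (lam * (n%:R + 1)), (rho - `|z - x0|).
split; rewrite ?subr_gt0 ?mulr_gt0 ?ltr_wpDl // => x xz.
have /zmin : `|x - x0| <= rho by have := ler_distD z x x0; lra.
have -> : x - a = (z - a) + (x - z) by rewrite [RHS]addrC addrA subrK.
rewrite (dotp_sqrD (z - a)) dotpZl -(opprB z a) (dotpNl (z - a)).
have := dotp_sqr_le (lexx `|x - z|); have := sqr_ge0 `|x - z|.
move: (dotp (z - a) (z - a)) (dotp (z - a) (x - z)) (dotp (x - z) (x - z)) => q p s.
move: (`|x - z| ^+ 2) => t t0 st.
have : lam * s <= lam * (n%:R * t) by rewrite ler_wpM2l // ltW.
have : 0 <= lam * t by rewrite mulr_ge0 // ltW.
nra.
Qed.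

(** * Proximal aiming *)

Section Aiming.
Context (R : realType) (n : nat) (T : R) (f : R -> 'rV[R]_n -> 'rV[R]_n).
Context (G : 'rV[R]_n -> R -> 'rV[R]_n) (fG : primitive T f G).
Context (Psi : 'rV[R]_n -> R) (Psi_lsc : lower_semicontinuous (EFin \o Psi)).
Context (x0 : 'rV[R]_n) (T0 : 0 < T) (rho M tau gamma : R).
Context (rho0 : 0 < rho) (M0 : 0 <= M) (tau0 : 0 <= tau) (tau_gamma : tau < gamma).
Context (M_tau : M * tau <= rho / 2).
Context (fM : forall r x, 0 <= r <= T -> `|x - x0| <= rho -> `|f r x| <= M).
Context (f_decr : forall z d, `|z - x0| <= rho -> prox_subgradient Psi z d ->
  {ae (@lebesgue_measure R), forall r, 0 <= r < gamma -> r <= T ->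
     dotp (f r z) d <= 0}).

(* Euler steps with the field frozen at the point minimizing
   [Psi + lam * |. - y j|^2], which lies at distance O(lam^{-1/2}) from [y j];
   after time [tau] these are ordinary Euler steps. *)
Lemma aiming_scheme (eps h0 : R) : 0 < eps -> eps <= 1 -> 0 < h0 ->
  exists N (y z : nat -> 'rV[R]_n),
    [/\ (0 < N)%N, T / N%:R <= h0, euler_scheme T G x0 N eps y z &
      forall j, (j <= N)%N -> j%:R * (T / N%:R) <= tau -> Psi (z j) <= Psi x0 + eps].
Proof.
move=> eps0 eps1 h00.
pose K := [set v : 'rV[R]_n | `|v - x0| <= rho].
have cK : compact K by exact: compact_norm_ball.
have Kx0 : K x0 by rewrite /K /= subrr normr0 ltW.
have [m0 _ m0P] := lsc_argmin cK (ex_intro _ _ Kx0) Psi_lsc.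
(* A penalized value of at most [Psi x0 + 1] leaves at most [C] for the penalty, [Psi m0] being the
   minimum on the ball. With [lam = C / e'^2] the minimizer is within [e'] of the node. *)
pose C := Psi x0 + 1 - Psi m0.
have C1 : 1 <= C by have := m0P _ Kx0; rewrite /C; lra.
pose e' := Num.min eps (rho / 4).
have e'0 : 0 < e' by rewrite lt_min eps0 divr_gt0.
have e'eps : e' <= eps by rewrite ge_min lexx.
have e'rho : e' <= rho / 4 by rewrite ge_min lexx orbT.
pose lam := C / e' ^+ 2.
have lam0 : 0 < lam by rewrite divr_gt0 ?exprn_gt0 //; lra.
have lamE s : lam * s <= C -> s <= e' ^+ 2.
  by rewrite /lam mulrAC ler_pdivrMr ?exprn_gt0 // ler_pM2l //; lra.
have /choice[aim aimP] : forall a, exists p, K p /\ forall x, K x ->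
    Psi p + lam * dotp (p - a) (p - a) <= Psi x + lam * dotp (x - a) (x - a).
  move=> a; have := lsc_argmin cK (ex_intro _ _ Kx0) (lsc_penalized (a := a) (ltW lam0) Psi_lsc).
  by move=> [p Kp pP]; exists p.
(* One step adds at most [D * h^2] to the penalized minimum, hence at most [D * tau * h] up to time
   [tau]; the bound [eps / (D * tau + 1)] on the step keeps this below [eps]. *)
pose D := lam * n%:R * M ^+ 2.
have D0 : 0 <= D by apply: mulr_ge0; [apply: mulr_ge0 => //; exact: ltW|exact: sqr_ge0].
have Dt : 0 < D * tau + 1 by rewrite ltr_wpDl // mulr_ge0.
pose h1 := Num.min (Num.min h0 (gamma - tau)) (eps / (D * tau + 1)).
have h10 : 0 < h1 by rewrite !lt_min h00 subr_gt0 tau_gamma divr_gt0.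
pose N := (Num.truncn (T / h1)).+1.
pose h := T / N%:R.
have N0 : (0 < N)%N by [].
have hpos : 0 < h := euler_step_gt0 T0 N0.
have hh1 : h < h1.
  rewrite /h ltr_pdivrMr ?ltr0n // mulrC -ltr_pdivrMr //.
  by have /truncn_itv/andP[] : 0 <= T / h1 by rewrite divr_ge0 // ltW.
have [hh0 hg hD] : [/\ h < h0, h < gamma - tau & h * (D * tau + 1) <= eps].
  move: hh1; rewrite !lt_min => /andP[/andP[-> ->]].
  by rewrite ltr_pdivlMr // => /ltW ->.
pose sel j a := if j%:R * h <= tau then aim a else a.
pose y := fix y j := if j is i.+1 then
  y i + (G (sel i (y i)) (i.+1%:R * h) - G (sel i (y i)) (i%:R * h)) else x0.
pose z j := sel j (y j).
have yS j : y j.+1 = y j + (G (z j) (j.+1%:R * h) - G (z j) (j%:R * h)) by [].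
have zaim j : j%:R * h <= tau -> z j = aim (y j) by rewrite /z /sel => ->.
have timeN j : (j <= N)%N -> 0 <= j%:R * h <= T := euler_time_le T0 N0 (j := j).
(* Consequences of the invariant at node [j]; the last, from [M * tau <= rho / 2] and
   [e' <= rho / 4], puts the minimizer strictly inside the ball, as the proximal subgradient
   requires. *)
have close j : `|y j - x0| <= M * (j%:R * h) -> j%:R * h <= tau ->
    Psi (z j) + lam * dotp (z j - y j) (z j - y j) <= Psi x0 + j%:R * h * (D * h) ->
    [/\ Psi (z j) <= Psi x0 + eps, `|z j - y j| <= e' & `|z j - x0| < rho].
  move=> yj jt zj.
  have jh0 : 0 <= j%:R * h by rewrite mulr_ge0 // ltW.
  have Deps : j%:R * h * (D * h) <= eps.
    apply: le_trans hD; apply: (@le_trans _ _ (tau * (D * h))).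
      by rewrite ler_wpM2r // mulr_ge0 // ltW.
    by rewrite mulrDr mulr1 mulrCA mulrA [h * _]mulrC [D * tau]mulrC; lra.
  have Kz : K (z j) by rewrite zaim //; case: (aimP (y j)).
  have sq0 : 0 <= dotp (z j - y j) (z j - y j).
    by apply: le_trans (sqr_norm_le_dotp _); rewrite sqr_ge0.
  have lsq0 : 0 <= lam * dotp (z j - y j) (z j - y j) by rewrite mulr_ge0 // ltW.
  have zy : `|z j - y j| <= e'.
    rewrite -ler_sqr ?nnegrE ?(ltW e'0) //; apply: le_trans (sqr_norm_le_dotp _) _.
    by apply: lamE; have := m0P _ Kz; rewrite /C; lra.
  split=> //; first by lra.
  have := ler_distD (y j) (z j) x0.
  move: (ler_wpM2l M0 jt) M_tau rho0 e'rho zy yj;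
  move: (`|_ - _|) (`|_ - _|) (`|_ - _|) (M * _) (M * _) => a b c d g; lra.
have inv j : (j <= N)%N -> j%:R * h <= tau ->
    `|y j - x0| <= M * (j%:R * h) /\
    Psi (z j) + lam * dotp (z j - y j) (z j - y j) <= Psi x0 + j%:R * h * (D * h).
  elim: j => [|j IH] jN jt.
    split; first by rewrite /= subrr normr0 mul0r mulr0.
    rewrite zaim // mul0r mul0r addr0.
    (* The competitor [x0] has zero penalty because the scheme starts there. *)
    have [_ /(_ _ Kx0)] := aimP (y 0%N); rewrite /= subrr dotpr0 mulr0 addr0.
    by [].
  have jS : j.+1%:R * h - j%:R * h = h := euler_stepS T N j.
  have jt' : j%:R * h <= tau by lra.
  have [yj zj] := IH (ltnW jN) jt'.
  have [_ zy zx] := close j yj jt' zj.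
  have /andP[tj0 _] := timeN j (ltnW jN); have /andP[_ tj1] := timeN _ jN.
  have tjj : j%:R * h <= j.+1%:R * h by lra.
  set dl := G (z j) (j.+1%:R * h) - G (z j) (j%:R * h).
  have dlM : `|dl| <= M * h.
    rewrite -jS; apply: (primitive_lipschitz fG) => // r rT.
    by apply: fM => //; exact: ltW.
  have y1 : y j.+1 = y j + dl by rewrite yS.
  split.
    rewrite y1 addrAC; apply: le_trans (ler_normD _ _) _.
    have -> : M * (j.+1%:R * h) = M * (j%:R * h) + M * h by rewrite -mulrDr; congr (_ * _); lra.
    exact: lerD.
  (* The old minimizer [z j] competes for the new penalty. In the expanded square the cross term is
     the inner product of the increment with a proximal subgradient at [z j], hence nonpositive, and
     the last term is at most [D * h^2] after scaling by [lam]. *)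
  rewrite zaim //; have [_ /(_ (z j) (ltW zx))] := aimP (y j.+1).
  move=> /le_trans; apply.
  have prox : prox_subgradient Psi (z j) ((2 * lam) *: (y j - z j)).
    apply: (penalized_argmin_prox_subgradient lam0 zx) => x xK.
    by rewrite zaim //; have [_] := aimP (y j); apply.
  have dle0 : dotp dl ((2 * lam) *: (y j - z j)) <= 0.
    apply: (primitive_dotp_le0 fG) => //.
    apply: lebesgue_aeS (f_decr (ltW zx) prox) => r H /andP[r1 r2].
    by apply: H; [apply/andP; split; lra|lra].
  have -> : z j - y j.+1 = (z j - y j) + (- dl) by rewrite y1 opprD addrA.
  rewrite dotp_sqrD dotpC dotpNl -/dl.
  have sqd := dotp_sqr_le dlM.
  have -> : dotp (- dl) (- dl) = dotp dl dl by rewrite dotpNl dotpC dotpNl opprK.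
  have dle : dotp dl ((2 * lam) *: (y j - z j)) = - (2 * lam * dotp dl (z j - y j)).
    by rewrite dotpC dotpZl -(opprB (z j)) dotpNl dotpC mulrN.
  have lsq : lam * dotp dl dl <= lam * (n%:R * (M * h) ^+ 2) by rewrite ler_wpM2l // ltW.
  have DE : lam * (n%:R * (M * h) ^+ 2) = h * (D * h) by rewrite /D; ring.
  have -> : j.+1%:R * h = j%:R * h + h by lra.
  rewrite DE in lsq; rewrite dle in dle0.
  move: zj lsq dle0; move: (dotp _ _) (dotp _ _) (dotp _ _) (D * h) => q p s Dh; nra.
exists N, y, z; split=> //.
- exact: ltW.
- split=> // j jN; have [jt|jt] := leP (j%:R * h) tau.
    have [yj zj] := inv j jN jt; have [_ zy _] := close j yj jt zj.
    exact: le_trans zy e'eps.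
  by rewrite /z /sel ifN -?ltNge // subrr normr0 ltW.
- move=> j jN jt; have [yj zj] := inv j jN jt.
  by have [] := close j yj jt zj.
Qed.
End Aiming.

(** * Invariance *)

Lemma invS_le_near (R : realType) (d : R) : 0 < d ->
  \forall k \near \oo, (k.+1%:R : R)^-1 <= d.
Proof.
move=> d0; near=> k; apply: ltW.
by near: k; exact: (near_infty_natSinv_lt (PosNum d0)).
Unshelve. all: by end_near. Qed.

(** Weak zeroing puts each [p_i e_i] in [F x], so every single product [p_i d_i] is nonpositive.
    This survives separate nonnegative factors on the coordinates, and the products are then
    summed. *)
Lemma ccone_dotp_le0 (R : realType) (n : nat) (F : 'rV[R]_n -> set 'rV[R]_n)
    (x q d : 'rV[R]_n) :
  weakly_zeroing F -> (hamiltonian F x d <= 0)%E -> ccone (F x) q -> dotp q d <= 0.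
Proof.
move=> Fz Hle [p Fp qp]; apply: sumr_le0 => i _; have [eta eta0 ->] := qp i.
rewrite -mulrA mulr_ge0_le0 // -dotp_delta dotpC -lee_fin; apply: le_trans Hle.
by apply: ereal_sup_ubound; exists (p ord0 i *: delta_mx ord0 i) => //; exact: Fz.
Qed.

Lemma local_decrease (R : realType) (n : nat) (F : 'rV[R]_n -> set 'rV[R]_n)
    (Psi : 'rV[R]_n -> R) (U : set 'rV[R]_n) (x0 : 'rV[R]_n) (T : R)
    (y : R -> 'rV[R]_n) :
  condition_U' F -> lower_semicontinuous (EFin \o Psi) -> open U -> U x0 ->
  (forall x, U x -> forall d, prox_subgradient Psi x d -> (hamiltonian F x d <= 0)%E) ->
  0 < T -> Traj T F x0 y ->
  exists2 tau, 0 < tau & forall t, 0 <= t <= T -> t <= tau -> Psi (y t) <= Psi x0.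
Proof.
move=> [FU Fz] Psi_lsc oU Ux0 H T0 /FU[|f [fC [gamma gamma0 fcone]] [_ uniq]].
  exact: ltW.
have [G fG] := caratheodory_primitive fC.
have [_ _ [c1 [c2 [c10 c20 fb]]]] := fC.
have [r /= r0 rU] : nbhs_ball x0 U by apply/nbhs_ballP; exact: open_nbhs_nbhs.
(* Inside radius [rho] both the cone condition on [f] and the Hamiltonian inequality on [U] are
   available. *)
pose rho := Num.min gamma (r / 2).
have rho0 : 0 < rho by rewrite lt_min gamma0 divr_gt0.
have rho_gamma : rho <= gamma by rewrite ge_min lexx.
have rhoU x : `|x - x0| <= rho -> U x.
  move=> xrho; apply: rU; rewrite -ball_normE /= distrC; apply: le_lt_trans xrho _.
  by rewrite gt_min; apply/orP; right; lra.
pose M := c1 + c2 * (`|x0| + rho).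
have M0 : 0 < M by apply: ltr_pwDl => //; rewrite mulr_ge0 ?addr_ge0 // ltW.
pose tau := Num.min (gamma / 2) (rho / 2 / M).
have tau0 : 0 < tau by rewrite lt_min !divr_gt0.
have tau_gamma : tau < gamma by rewrite gt_min; apply/orP; left; lra.
have M_tau : M * tau <= rho / 2 by rewrite mulrC -ler_pdivlMr // ge_min lexx orbT.
have fM s x : 0 <= s <= T -> `|x - x0| <= rho -> `|f s x| <= M.
  move=> sT xrho; apply: le_trans (fb _ _ sT) _; rewrite lerD2l ler_wpM2l ?(ltW c20) //.
  rewrite -[x](subrK x0) addrC; apply: le_trans (ler_normD _ _) _.
  by rewrite lerD2l.
have f_decr z d : `|z - x0| <= rho -> prox_subgradient Psi z d ->
    {ae (@lebesgue_measure R), forall s, 0 <= s < gamma -> s <= T -> dotp (f s z) d <= 0}.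
  move=> zrho zd; apply: lebesgue_aeS fcone => s fs sg sT.
  apply: (ccone_dotp_le0 Fz (H z (rhoU _ zrho) d zd)).
  by apply: fs => //; exact: le_trans rho_gamma.
have inv0 k : 0 < (k.+1%:R : R)^-1 by rewrite invr_gt0.
have inv1 k : (k.+1%:R : R)^-1 <= 1 by rewrite invf_le1 // ler1n.
have /choice[Nyz NyzP] : forall k, exists Nyz : nat * (nat -> 'rV[R]_n) * (nat -> 'rV[R]_n),
    [/\ (0 < Nyz.1.1)%N, T / Nyz.1.1%:R <= k.+1%:R^-1,
      euler_scheme T G x0 Nyz.1.1 k.+1%:R^-1 Nyz.1.2 Nyz.2 &
      forall j, (j <= Nyz.1.1)%N -> j%:R * (T / Nyz.1.1%:R) <= tau ->
        Psi (Nyz.2 j) <= Psi x0 + k.+1%:R^-1].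
  move=> k; have [N [u [z uz]]] := aiming_scheme fG Psi_lsc T0 rho0 (ltW M0)
    (ltW tau0) tau_gamma M_tau fM f_decr (inv0 k) (inv1 k) (inv0 k).
  by exists (N, u, z).
have E k := let: And4 _ _ E _ := NyzP k in E.
have N0 k := let: And4 N0 _ _ _ := NyzP k in N0.
have h_cvg d : 0 < d -> \forall k \near \oo, T / (Nyz k).1.1%:R <= d.
  by move=> /invS_le_near; apply: filterS => k; apply: le_trans; have [] := NyzP k.
have [yh [yh_sol yh_z]] := euler_limit fC fG T0 E N0 inv1 h_cvg (@invS_le_near R).
exists tau => // t tT ttau; rewrite -(uniq _ yh_sol t tT) leNgt; apply/negP => lt.
(* Lower semicontinuity keeps [Psi] above the midpoint [c] near [yh t], whereas freezing points
   arbitrarily near [yh t] have values at most [Psi x0 + 1 / (k + 1)], below [c] for large [k]. *)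
pose c := (Psi x0 + Psi (yh t)) / 2.
have [|V nV VP] := Psi_lsc (yh t) c; first by rewrite /= lte_fin /c; lra.
have [d /= d0 dV] : nbhs_ball (yh t) V by apply/nbhs_ballP.
have d2 : 0 < d / 2 by rewrite divr_gt0.
have c0 : 0 < c - Psi x0 by rewrite /c; lra.
have [k [j [/= kc jN jt zt]]] := yh_z t tT _ d2 _ (invS_le_near c0).
have [_ _ _ /(_ j jN (le_trans jt ttau)) Psiz] := NyzP k.
have /VP : V ((Nyz k).2 j).
  by apply: dV; rewrite -ball_normE /= distrC; apply: le_lt_trans zt _; lra.
by rewrite /= lte_fin ltNge => /negP; apply; apply: le_trans Psiz _; rewrite -lerBrDl.
Qed.

Lemma Traj_shift (R : realType) (n : nat) (F : 'rV[R]_n -> set 'rV[R]_n)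
    (x0 : 'rV[R]_n) (T s : R) (y : R -> 'rV[R]_n) :
  0 <= s -> Traj T F x0 y -> Traj (T - s) F (y s) (fun t => y (t + s)).
Proof.
move=> s0 [yac _ yF]; split; last 1 first.
- apply: lebesgue_aeS (negligible_shift s yF) => t Ht /andP[t0 tT].
  have [|dy Fy] := Ht; first by apply/andP; split; lra.
  have E : (fun h => h^-1 *: (((fun t => y (t + s)) \o shift t) (h *: 1) - y (t + s))) =
      (fun h => h^-1 *: ((y \o shift (t + s)) (h *: 1) - y (t + s))).
    by apply/funext => h; rewrite /= addrA.
  split; first by rewrite /derivable E.
  by move: Fy; rewrite !derive1E /derive E.
- move=> e /yac[d d0 dP]; exists d => // m u v uv uv_triv uv_sum.
  apply: (dP m (fun i => u i + s) (fun i => v i + s)).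
  + by move=> i; have [u0 [uv1 v1]] := uv i; split; [|split]; lra.
  + move=> i j _ _ [x [/=]]; rewrite !in_itv/= => xi xj; apply: uv_triv => //.
    by exists (x - s); split; rewrite /= in_itv/=; lra.
  + by under eq_bigr do rewrite opprD addrACA subrr addr0.
- by rewrite add0r.
Qed.

Unset Implicit Arguments.
Set Strict Implicit.

Theorem theorem1 (R : realType) (n : nat) (F : 'rV[R]_n -> set 'rV[R]_n)
    (Psi : 'rV[R]_n -> R)
    (F_nonempty : forall x, F x !=set0)
    (F_U' : condition_U' F)
    (Psi_lsc : lower_semicontinuous (EFin \o Psi))
    (H_le0 : exists U : set 'rV[R]_n,
       [/\ open U, [set x | Psi x <= 0] `<=` U &
           forall x, U x -> forall d, prox_subgradient Psi x d ->
             (hamiltonian F x d <= 0)%E]) :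
  strongly_invariant F [set x | Psi x <= 0].
Proof.
have [U [oU SU H]] := H_le0.
move=> T y T0 yT /= y0 t tT; rewrite leNgt; apply/negP => yt.
pose B := [set s : R | 0 <= s <= T /\ 0 < Psi (y s)].
have Bt : B t by [].
have lbB : lbound B 0 by move=> s [/andP[]].
have hB : has_inf B by split; [exists t|exists 0].
pose s := inf B.
have s0 : 0 <= s by apply: lb_le_inf => //; exists t.
have sB b : B b -> s <= b by move=> Bb; apply: ge_inf => //; exists 0.
have /andP[_ tT'] := tT.
have st : s <= t by exact: sB.
have below r : 0 <= r -> r < s -> Psi (y r) <= 0.
  move=> r0 rs; rewrite leNgt; apply/negP => yr.
  have : s <= r by apply: sB; split=> //; apply/andP; split; lra.
  by rewrite leNgt rs.
have ys : Psi (y s) <= 0.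
  have [s00|sn0] := eqVneq s 0; first by rewrite s00.
  have sp : 0 < s by rewrite lt_neqAle eq_sym sn0.
  (* If [Psi (y s)] were positive, [Psi] would be positive near [y s], hence at [y r] for some
     [r < s] close to [s], against the choice of [s]. *)
  rewrite leNgt; apply/negP => ys; have [|V nV VP] := Psi_lsc (y s) 0.
    by rewrite /= lte_fin.
  have [e /= e0 eV] : nbhs_ball (y s) V by apply/nbhs_ballP.
  have [yac _ _] := yT; have [d d0 dP] := yac e e0.
  pose r := Num.max 0 (s - d / 2).
  have rs : r < s by rewrite gt_max sp; lra.
  have r0 : 0 <= r by rewrite le_max lexx.
  have rd : s - d / 2 <= r by rewrite le_max lexx orbT.
  (* Absolute continuity with a single interval serves as continuity of [y] at [s]. *)
  have := dP 1%N (fun=> r) (fun=> s); rewrite !big_ord1 => dist.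
  have /VP : V (y r).
    apply: eV; rewrite -ball_normE /=; apply: dist; last by lra.
      by move=> _; split; [|split]; lra.
    by move=> i j _ _ _; rewrite !ord1.
  by rewrite /= lte_fin ltNge below.
have sT : s < T.
  rewrite lt_neqAle (le_trans st) // andbT; apply: contraTneq yt => sT.
  by rewrite (_ : t = s) -?leNgt //; lra.
have [|tau tau0 tauP] := local_decrease F_U' Psi_lsc oU (SU _ ys) H _ (Traj_shift s0 yT).
  by rewrite subr_gt0.
(* Restarted at [y s], the trajectory keeps [Psi] at most [Psi (y s) <= 0] for a time [tau], so no
   bad time precedes [s + tau]. *)
have : s + tau <= s.
  apply: lb_le_inf; first by exists t.
  move=> b Bb; have sb := sB b Bb; have [/andP[b0 bT] yb] := Bb.
  rewrite leNgt; apply/negP => bs; have := tauP (b - s).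
  rewrite subrK => /(_ _ _) yb'.
  have : Psi (y b) <= Psi (y s) by apply: yb'; [apply/andP; split; lra|lra].
  by lra.
by lra.
Qed.
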